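(* Let $D$ be a northwest diagram and $r$ a row index such that the set of columns occupied by row $r$ of $D$ is contained in the set of columns occupied by row $r+1$. Suppose the Kohnert crystals decompose into Demazure crystals as $\mathrm{KD}(s_rD)\cong\bigsqcup_{i=1}^s\mathcal{B}^{u^{(i)}}_{\mu^{(i)}}$ and $\mathrm{KD}(D)\cong\bigsqcup_{i=1}^t\mathcal{B}^{v^{(i)}}_{\nu^{(i)}}$, where each permutation $u^{(i)},v^{(i)}$ is of minimal length among permutations giving the same Demazure crystal. Then $s=t$, and (with the components indexed compatibly) for all $i$ we have $\mu^{(i)}=\nu^{(i)}$ and $u^{(i)}\preceq v^{(i)}$ in Bruhat order.
   Context: A diagram is a finite set of cells $(i,j)\in\mathbb{Z}_{>0}^2$ ($i$ row, $j$ column), rows numbered top to bottom. $D$ is northwest if whenever $(j,k),(i,l)\in D$ with $i<j$, $k<l$, then $(i,k)\in D$. $s_rD$ is $D$ with rows $r$ and $r+1$ exchanged. A Kohnert move selects the rightmost cell of a row and moves it up (toward row 1) within its column to the first empty position above it, jumping over cells, if one exists; $\mathrm{KD}(D)$ is the set of diagrams reachable from $D$ by Kohnert moves (including $D$). Kohnert raising operators: for $i\ge1$, $i$-pair cells in rows $i,i+1$ iteratively by pairing an unpaired cell in row $i+1$ with an unpaired cell in row $i$ weakly to its left whenever all cells in rows $i,i+1$ lying between them are already paired; $e_i(T)=0$ if all cells of row $i+1$ are paired, else $e_i$ moves the rightmost unpaired cell of row $i+1$ to row $i$. The weight of a diagram is its vector of row counts. For $D$ northwest, $\mathrm{KD}(D)$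 is closed under the $e_i$ (when nonzero), and the Kohnert crystal on $D$ is $\mathrm{KD}(D)$ with these operators; it is known to be isomorphic (via a weight-preserving bijection commuting with all $e_i$) to a disjoint union of Demazure crystals. For a partition $\lambda$, $\mathcal{B}_\lambda$ is the $GL_n$ (type $A_{n-1}$) crystal of highest weight $\lambda$ with highest weight element $u_\lambda$; for a subset $X$, $\mathfrak{D}_i(X)=\{b\in\mathcal{B}_\lambda: e_i^k(b)\in X\text{ for some }k\ge0\}$, $\mathfrak{D}_w=\mathfrak{D}_{i_m}\cdots\mathfrak{D}_{i_1}$ for an expression $w=s_{i_m}\cdots s_{i_1}$, and the Demazure crystal is $\mathcal{B}^w_\lambda=\mathfrak{D}_w(\{u_\lambda\})$. *)

(* Defs.v *)
From mathcomp Require Import all_boot all_fingroup.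
From mathcomp Require Import finmap.
From mathcomp Require Import classical_sets functions.

Set Implicit Arguments.
Unset Strict Implicit.
Unset Printing Implicit Defensive.

Local Open Scope fset_scope.
Local Open Scope classical_set_scope.
Local Open Scope nat_scope.

(* Rows, columns, tableau entries and crystal operators are numbered from 0:
   the cell (i, j), the entry i and the operator e_i of the 1-based literature
   are (i.-1, j.-1), i.-1 and e_(i.-1) here. *)

Definition diagram := {fset nat * nat}.

Definition northwest (D : diagram) : Prop :=
  forall i j k l, i < j -> k < l ->
    (j, k) \in D -> (i, l) \in D -> (i, k) \in D.

Definition swap_index (r i : nat) : nat :=
  if i == r then r.+1 else if i == r.+1 then r else i.

Definition swap_rows (r : nat) (D : diagram) : diagram :=
  [fset (swap_index r c.1, c.2) | c in D]%fset.

Definition kohnert_move (D D' : diagram) : Prop :=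
  exists i j i' : nat,
    [/\ (i, j) \in D /\ (forall k, (i, k) \in D -> k <= j),
        i' < i,
        (i', j) \notin D,
        (forall k, i' < k < i -> (k, j) \in D)
      & D' = ((i', j) |` (D `\ (i, j)))%fset].

Inductive kohnert_reach (D : diagram) : diagram -> Prop :=
| KohnertRefl : kohnert_reach D D
| KohnertStep T T' :
    kohnert_reach D T -> kohnert_move T T' -> kohnert_reach D T'.

Definition KD (D : diagram) : set diagram := [set T | kohnert_reach D T].

(* Iterated pairing of the elements of B with elements of A weakly to their
   left.  An element common to A and B stands for two cells in the same column,
   the one in A preceding the one in B.  M lists the pairs already formed. *)
Definition pairable (A B : seq nat) (M : seq (nat * nat)) (p : nat * nat) :=
  [&& p.1 <= p.2, p.1 \notin unzip1 M, p.2 \notin unzip2 M,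
      all (fun x => (p.1 < x <= p.2) ==> (x \in unzip1 M)) A
    & all (fun y => (p.1 <= y < p.2) ==> (y \in unzip2 M)) B].

Definition pair_step (A B : seq nat) (M : seq (nat * nat)) :=
  if [seq p <- [seq (a, b) | a <- A, b <- B] | pairable A B M p] is p :: _
  then p :: M else M.

(* Each effective step pairs a new element of A, so size A steps exhaust the
   process. *)
Definition pairing (A B : seq nat) : seq (nat * nat) :=
  iter (size A) (pair_step A B) [::].

Definition unpaired (A B : seq nat) : seq nat :=
  [seq b <- B | b \notin unzip2 (pairing A B)].

Definition rightmost (s : seq nat) : option nat :=
  if s is [::] then None else Some (\max_(x <- s) x).

Definition row_columns (T : diagram) (i : nat) : seq nat :=
  [seq c.2 | c <- enum_fset T & c.1 == i].

(* The value None of a crystal operator stands for 0. *)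
Definition kohnert_raise (i : nat) (T : diagram) : option diagram :=
  omap (fun c => ((i, c) |` (T `\ (i.+1, c)))%fset)
    (rightmost (unpaired (row_columns T i) (row_columns T i.+1))).

Definition diagram_weight (T : diagram) (i : nat) : nat :=
  size (row_columns T i).

(* The GL_n crystal of highest weight lam is realized on semistandard Young
   tableaux, in English notation; a partition with at most n parts is padded
   with zeros to length n, and a tableau has n (possibly empty) rows. *)
Definition tableau := seq (seq nat).

Definition is_partition n (lam : n.-tuple nat) : bool := sorted geq lam.

Definition ssyt n (lam : n.-tuple nat) : set tableau :=
  [set T | [&& shape T == lam,
      all (all (fun x => x < n)) T,
      all (sorted leq) T
    & sorted (fun r1 r2 => all (fun p => p.1 < p.2) (zip r1 r2)) T]].

Definition word_raise (i : nat) (w : seq nat) : option (seq nat) :=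
  let positions x := [seq p <- iota 0 (size w) | nth 0 w p == x] in
  omap (fun p => set_nth 0 w p i)
    (rightmost (unpaired (positions i) (positions i.+1))).

(* Signature rule on the reading word, rows from top to bottom, each row from
   right to left. *)
Definition tableau_raise (i : nat) (T : tableau) : option tableau :=
  omap (fun w => map rev (reshape (shape T) w))
    (word_raise i (flatten (map rev T))).

Definition tableau_weight (T : tableau) (i : nat) : nat :=
  count_mem i (flatten T).

Definition highest n (lam : n.-tuple nat) : tableau :=
  mkseq (fun i => nseq (nth 0 lam i) i) n.

Definition demazure_op n (lam : n.-tuple nat) (i : nat) (X : set tableau) :
    set tableau :=
  [set b | ssyt lam b /\
     exists k, exists2 c, iter k (obind (tableau_raise i)) (Some b) = Some c
                        & X c].

Definition adjacent_transposition n (i : 'I_n.-1) : 'S_n :=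
  tperm (widen_ord (leq_pred n) i)
        (Ordinal (etrans (esym (ltn_predRL i n)) (ltn_ord i))).

(* The sequence [:: i_1; ...; i_m] encodes the expression s_(i_m) ... s_(i_1):
   products in 'S_n apply their left factor first. *)
Definition expression_perm n (e : seq 'I_n.-1) : 'S_n :=
  (\prod_(i <- e) adjacent_transposition i)%g.

Definition perm_length n (w : 'S_n) : nat :=
  #|[set p : 'I_n * 'I_n | (p.1 < p.2) && (w p.2 < w p.1)]%SET|.

Definition reduced_expression n (w : 'S_n) (e : seq 'I_n.-1) : Prop :=
  expression_perm e = w /\ size e = perm_length w.

Definition demazure_expression n (lam : n.-tuple nat) (e : seq 'I_n.-1) :
    set tableau :=
  foldl (fun X (i : 'I_n.-1) => demazure_op lam i X) [set highest lam] e.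

(* All reduced expressions of w yield the same set.  The restriction to reduced
   expressions is needed: demazure_op lam i is idempotent, whereas s_i is an
   involution. *)
Definition demazure n (lam : n.-tuple nat) (w : 'S_n) : set tableau :=
  [set b | exists2 e, reduced_expression w e & demazure_expression lam e b].

Definition minimal_for_demazure n (lam : n.-tuple nat) (w : 'S_n) : Prop :=
  forall w' : 'S_n, demazure lam w' = demazure lam w ->
    perm_length w <= perm_length w'.

Definition bruhat n (u v : 'S_n) : bool :=
  connect [rel x y : 'S_n | (perm_length x < perm_length y) &&
    [exists a, exists b, y == (x * tperm a b)%g]] u v.

(* The point (k, b) of the disjoint union is the element b of its k-th
   component. *)
Definition demazure_decomposition n (D : diagram) (s : nat)
    (mu : 'I_s -> n.-tuple nat) (u : 'I_s -> 'S_n) : Prop :=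
  let union := [set x : 'I_s * tableau | demazure (mu x.1) (u x.1) x.2] in
  exists f : 'I_s * tableau -> diagram,
    [/\ set_bij union (KD D) f,
        (forall x, union x -> diagram_weight (f x) =1 tableau_weight x.2)
      & (forall x (i : 'I_n.-1), union x ->
           kohnert_raise i (f x) =
           omap (fun b => f (x.1, b)) (tableau_raise i x.2))].

(* Main.v *)
(* Every Demazure crystal has a unique highest weight element, so the components
   are indexed by the elements killed by all raising operators.  These are the
   same for D and for E = s_r D.  Indeed KD(E) is contained in KD(D), since row r
   of D is an initial segment of row r+1, so that E is reached from D by Kohnert
   moves; conversely an element of KD(D) killed by e_r lies in KD(E), because
   Kohnert paths from D can be followed from E up to a set of unpaired cells of
   row r+1.  As the operators e_i are injective, each component of KD(E) embeds in
   the component of KD(D) with the same highest weight element, which gives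
   mu = nu and an inclusion of Demazure crystals B^u <= B^v.

   A tableau is in B^w if and only if its columns are initial segments of a chain
   of permutations, increasing in Bruhat order and bounded by w.  This condition
   is compatible with the operators e_i, hence does not depend on the choice of a
   reduced word, and it depends on w only up to the stabilizer of lambda.
   Therefore a permutation of minimal length increases along the blocks of equal
   parts of lambda, and applying the condition for v to the key tableau of u
   compares u and v on the ends of these blocks, which implies u <= v. *)

Require Import Defs.
From mathcomp Require Import all_boot all_fingroup.
From mathcomp Require Import finmap.
From mathcomp Require Import zify.

Set Implicit Arguments.
Unset Strict Implicit.
Unset Printing Implicit Defensive.

(** * The signature rule *)

(** The obstacle is that [tableau_raise] reads a tableau by rows, whereas the chain condition speaks
    of columns. The signature rule is therefore restated as a maximum over prefixes of the excess of
    letters i+1 over letters i. In this form it passes from the row reading to the column reading,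
    where e_i changes a single value of [below]. Permutations are compared through the numbers
    [rank x a b], because the smaller and the larger of x and x s_i have ranks given by [minn] and
    [maxn] formulas in the ranks of x. Monotonicity of both choices is then immediate, and applying
    them to selected members of a chain yields the chain of the raised or lowered tableau.
    Injectivity of e_i is obtained on tableaux and is carried to diagrams by the given
    bijections. *)

Section Pairing.

Variables A B : seq nat.

(** The invariant of [pair_step]: each pair was pairable when it joined the older pairs, which form
    the tail of the list. *)
Fixpoint formed (M : seq (nat * nat)) : bool :=
  if M is p :: M' then
    [&& p.1 \in A, p.2 \in B, pairable A B M' p & formed M']
  else true.

Lemma pair_step_formed M : formed M -> formed (pair_step A B M).
Proof.
move=> fM; rewrite /pair_step.
case E: [seq p <- _ | _] => [//|p s].
have : p \in [seq p <- [seq (a, b) | a <- A, b <- B] | pairable A B M p].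
  by rewrite E mem_head.
rewrite mem_filter => /andP[pP /allpairsP[[a b] /= [aA bB def_p]]].
by rewrite /= pP fM def_p /= aA bB.
Qed.

Lemma formed_pairing : formed (pairing A B).
Proof. by rewrite /pairing; elim: (size A) => //= k; apply: pair_step_formed. Qed.

Lemma formed_uniq M : formed M -> uniq (unzip1 M) && uniq (unzip2 M).
Proof.
elim: M => //= p M IH /and4P[_ _ /and5P[_ -> -> _ _] /IH /andP[-> ->]].
by [].
Qed.

Lemma formed_sub M p : formed M -> p \in M ->
  [/\ p.1 \in A, p.2 \in B & p.1 <= p.2].
Proof.
elim: M => //= q M IH /and4P[q1 q2 /andP[q3 _] /IH{}IH].
by rewrite inE => /orP[/eqP->|/IH].
Qed.

Lemma formed_inner M p y : formed M -> p \in M -> y \in B ->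
  p.1 <= y < p.2 -> y \in unzip2 M.
Proof.
elim: M => //= q M IH /and4P[q1 q2 /and5P[_ _ _ _ /allP q3] /IH{}IH].
rewrite inE => /orP[/eqP->|pM] yB hy; rewrite inE.
  by have /implyP/(_ hy) -> := q3 _ yB; rewrite orbT.
by rewrite IH ?orbT.
Qed.

Lemma pair_step_stuck k :
  size (iter k (pair_step A B) [::]) = k \/
  pair_step A B (iter k (pair_step A B) [::]) = iter k (pair_step A B) [::].
Proof.
elim: k => [|k IH] /=; first by left.
case: IH => [sM|stuck]; last by right; rewrite !stuck.
move: (iter k _ _) sM => M sM; rewrite {1}/pair_step.
case E: [seq p <- _ | _] => [|p s] /=; last by left; rewrite sM.
by right; rewrite /pair_step E /= E.
Qed.

(** Each effective step adds a pair; after [size A] steps either the process is stuck, or there are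
    [size A] pairs with distinct left ends, which exhaust A. *)
Lemma pairing_maximal a b :
  a \in A -> b \in B -> ~~ pairable A B (pairing A B) (a, b).
Proof.
move=> aA bB; apply/negP => pab.
have [sM|] := pair_step_stuck (size A); rewrite -/(pairing A B).
  have [_ eqA] : (size (unzip1 (pairing A B)) = size A) * (unzip1 (pairing A B) =i A).
    apply: uniq_min_size; first by have /andP[] := formed_uniq formed_pairing.
      by move=> x /mapP[p /(formed_sub formed_pairing)[? _ _] ->].
    by rewrite size_map /pairing sM.
  by case/and5P: pab => _ /=; rewrite eqA aA.
rewrite /pair_step; case E: [seq p <- _ | _] => [|p s].
  have : (a, b) \in [seq p <- [seq (a, b) | a <- A, b <- B]
                    | pairable A B (pairing A B) p].
    by rewrite mem_filter pab allpairs_f.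
  by rewrite E.
by move/(congr1 size) => /= /eqP; rewrite eqn_leq ltnn.
Qed.

(** If a were unpaired, take the last unpaired x of A up to b and the first unpaired y of B from x
    on: nothing unpaired lies between them, so (x, y) would still be pairable. *)
Lemma unpaired_closed a b :
  b \in unpaired A B -> a \in A -> a <= b -> a \in unzip1 (pairing A B).
Proof.
rewrite mem_filter => /andP[bM bB] aA ab; apply/idPn => aM.
set M := pairing A B in bM aM *.
pose P x := [&& x \in A, x <= b & x \notin unzip1 M].
have exP : exists x, P x by exists a; rewrite /P aA ab.
have ubP x : P x -> x <= b by case/and3P.
have [x /and3P[xA xb xM] maxx] := ex_maxnP exP ubP.
pose Q y := [&& y \in B, x <= y & y \notin unzip2 M].
have exQ : exists y, Q y by exists b; rewrite /Q bB xb.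
have [y /and3P[yB xy yM] miny] := ex_minnP exQ.
have yb : y <= b by apply: miny; rewrite /Q bB xb.
have := pairing_maximal xA yB; rewrite /pairable -/M xM yM /= xy /=.
rewrite negb_and => /orP[] /negP[]; apply/allP => z zI; apply/implyP => /andP[h1 h2].
  apply/idPn => zM; have := maxx z; rewrite /P zI zM (leq_trans h2 yb) /=.
  by move/(_ isT); rewrite leqNgt h1.
apply/idPn => zM; have := miny z; rewrite /Q zI zM h1 /=.
by move/(_ isT); rewrite leqNgt h2.
Qed.

(** A pair is formed only when the elements of B between its ends are paired, so it cannot enclose
    b. *)
Lemma pairing_unpaired p b : p \in pairing A B -> b \in unpaired A B ->
  p.1 <= b -> p.2 < b.
Proof.
move=> pM; rewrite mem_filter => /andP[bM bB] pb; rewrite ltn_neqAle.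
apply/andP; split.
  by apply: contraNneq bM => <-; apply: map_f.
rewrite leqNgt; apply: contra bM => bp.
by apply: (formed_inner formed_pairing pM bB); rewrite pb.
Qed.

Hypotheses (uA : uniq A) (uB : uniq B).

(** The elements of A in the window are all paired, with partners in the window strictly before b; b
    itself is the extra element of B. *)
Lemma unpaired_count s b : s <= b -> b \in unpaired A B ->
  count (fun x => s <= x < b.+1) A < count (fun x => s <= x < b.+1) B.
Proof.
move=> sb bU; pose M := pairing A B; have fM : formed M := formed_pairing.
pose L := [seq p <- M | s <= p.1 <= b].
have subL p : p \in L -> [/\ p \in M, s <= p.1 & p.1 <= b].
  by rewrite mem_filter => /andP[/andP[]].
have /andP[u1 u2] := formed_uniq fM.
have leA : count (fun x => s <= x < b.+1) A <= size L.
  rewrite -size_filter -(size_map fst); apply: uniq_leq_size; first exact: filter_uniq.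
  move=> x; rewrite mem_filter => /andP[/andP[sx xb] xA].
  have /mapP[p pM def_x] := unpaired_closed bU xA xb.
  by rewrite def_x; apply: map_f; rewrite mem_filter -def_x sx -ltnS xb.
apply: leq_ltn_trans leA _.
have -> : (size L).+1 = size (b :: unzip2 L) by rewrite /= size_map.
rewrite -size_filter; apply: uniq_leq_size => /=.
  apply/andP; split.
    apply/mapP => -[p /subL[pM _ pb] def_b].
    by have := pairing_unpaired pM bU pb; rewrite -def_b ltnn.
  apply: subseq_uniq u2; apply: map_subseq; exact: filter_subseq.
move=> x; rewrite inE mem_filter => /orP[/eqP->|/mapP[p /subL[pM sp pb] ->]].
  by rewrite sb leqnn; move: bU; rewrite mem_filter => /andP[].
have [_ -> pp] := formed_sub fM pM.
by rewrite (leq_trans sp pp) ltnS (ltnW (pairing_unpaired pM bU pb)).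
Qed.

(** Partners lie weakly to the left, and the second hypothesis keeps them from leaving the window at
    s. *)
Lemma paired_count s t :
  (forall y, y \in B -> s <= y < t -> y \in unzip2 (pairing A B)) ->
  (forall p, p \in pairing A B -> s <= p.2 -> s <= p.1) ->
  count (fun x => s <= x < t) B <= count (fun x => s <= x < t) A.
Proof.
move=> hB hM; pose M := pairing A B; have fM : formed M := formed_pairing.
pose L := [seq p <- M | s <= p.2 < t].
have subL p : p \in L -> [/\ p \in M, s <= p.2 & p.2 < t].
  by rewrite mem_filter => /andP[/andP[]].
have /andP[u1 u2] := formed_uniq fM.
apply: (@leq_trans (size L)).
  rewrite -size_filter -(size_map snd); apply: uniq_leq_size; first exact: filter_uniq.
  move=> x; rewrite mem_filter => /andP[xst xB].
  have /mapP[p pM def_x] := hB _ xB xst.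
  by rewrite def_x; apply: map_f; rewrite mem_filter -def_x xst.
rewrite -size_filter -(size_map fst); apply: uniq_leq_size.
  apply: subseq_uniq u1; apply: map_subseq; exact: filter_subseq.
move=> x /mapP[p /subL[pM sp pt] ->].
have [pA _ pp] := formed_sub fM pM.
by rewrite mem_filter pA (hM _ pM sp) (leq_ltn_trans pp pt).
Qed.

End Pairing.

Lemma rightmost_None s : rightmost s = None -> s = [::].
Proof. by case: s. Qed.

Lemma rightmost_Some s p : rightmost s = Some p ->
  p \in s /\ forall x, x \in s -> x <= p.
Proof.
case: s => // y s [<-]; split; last by move=> x xs; apply: leq_bigmax_seq.
elim: s y => [|z s IH] y; first by rewrite big_cons big_nil maxn0 mem_head.
rewrite big_cons inE; case: leqP => [|_]; last by rewrite eqxx.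
by rewrite IH orbT.
Qed.

Definition occ (x : nat) (s : seq nat) : nat := count_mem x s.

Section Word.

Variables (i : nat) (w : seq nat).

Let pos (x : nat) := [seq p <- iota 0 (size w) | nth 0 w p == x].

Lemma count_pos (x t : nat) : t <= size w ->
  count (fun p => p < t) (pos x) = occ x (take t w).
Proof.
move=> tw; rewrite /occ count_filter.
have -> : take t w = [seq nth 0 w p | p <- iota 0 t] by rewrite map_nth_iota0.
rewrite count_map.
have -> : iota 0 (size w) = iota 0 t ++ iota t (size w - t).
  by rewrite -[X in iota X (_ - _)]add0n -iotaD subnKC.
rewrite count_cat [X in _ + X = _](_ : _ = 0) ?addn0.
  apply: eq_in_count => p; rewrite mem_iota add0n /= => ->.
  by rewrite /= eq_sym.
rewrite -(count_pred0 (iota t (size w - t))); apply: eq_in_count => p.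
by rewrite mem_iota => /andP[tp _] /=; rewrite ltnNge tp.
Qed.

Lemma count_pos_segment (x s t : nat) : s <= t -> t <= size w ->
  occ x (take s w) + count (fun p => s <= p < t) (pos x) =
  occ x (take t w).
Proof.
move=> st tw; rewrite -!count_pos ?(leq_trans st) //.
rewrite -(count_predUI (fun p => p < s)).
rewrite [X in _ + X = _](_ : _ = 0) ?addn0.
  by apply: eq_count => p /=; apply/idP/idP; lia.
by rewrite -(count_pred0 (pos x)); apply: eq_count => p /=; apply/idP; lia.
Qed.

Let upos (x : nat) : uniq (pos x). Proof. exact/filter_uniq/iota_uniq. Qed.

Lemma word_raise_None : word_raise i w = None ->
  forall t, occ i.+1 (take t w) <= occ i (take t w).
Proof.
rewrite /word_raise -/(pos i) -/(pos i.+1).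
case E: rightmost => [//|] _ t; wlog tw : t / t <= size w.
  by move=> H; case: (leqP t (size w)) => [/H//|/ltnW tw];
    rewrite take_oversize // -(take_size w) H.
rewrite -(@count_pos_segment i.+1 0) // -(@count_pos_segment i 0) // !take0 !add0n.
apply: paired_count => // y yB _; apply/idPn => yM.
have : y \in unpaired (pos i) (pos i.+1) by rewrite mem_filter yM.
by rewrite (rightmost_None E).
Qed.

(** The signature rule as a maximum: the changed letter ends the shortest prefix in which the excess
    of i+1 over i is maximal. Excesses are compared by sums to avoid truncated subtraction. *)
Lemma word_raise_Some w' : word_raise i w = Some w' -> exists p,
  [/\ p < size w, nth 0 w p = i.+1, w' = set_nth 0 w p i,
   forall t, t <= p -> occ i.+1 (take t w) + occ i (take p.+1 w) <
                       occ i.+1 (take p.+1 w) + occ i (take t w)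
 & forall t, occ i.+1 (take t w) + occ i (take p.+1 w) <=
             occ i.+1 (take p.+1 w) + occ i (take t w)].
Proof.
rewrite /word_raise -/(pos i) -/(pos i.+1).
case E: rightmost => [p|//] [<-]; have [pU pmax] := rightmost_Some E.
have := pU; rewrite mem_filter => /andP[pM pB].
have := pB; rewrite mem_filter mem_iota add0n => /andP[/eqP wp /= pw].
have before t : t <= p -> occ i.+1 (take t w) + occ i (take p.+1 w) <
                       occ i.+1 (take p.+1 w) + occ i (take t w).
  move=> tp; have tp1 : t <= p.+1 by lia.
  have := unpaired_count (upos i) tp pU.
  have := count_pos_segment i tp1 pw; have := count_pos_segment i.+1 tp1 pw.
  by lia.
exists p; split => // t; case: (leqP t p) => [/before/ltnW //|pt].
wlog tw : t pt / t <= size w.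
  move=> H; case: (leqP t (size w)) => [/H->//|/ltnW tw].
  rewrite (_ : take t w = take (size w) w) ?H //.
  by rewrite take_size take_oversize.
have := count_pos_segment i pt tw; have := count_pos_segment i.+1 pt tw.
suff: count (fun x => p < x < t) (pos i.+1) <= count (fun x => p < x < t) (pos i).
  by lia.
apply: paired_count => //.
  move=> y yB /andP[py _]; apply/idPn => yM.
  have : y \in unpaired (pos i) (pos i.+1) by rewrite mem_filter yM.
  by move/pmax; rewrite leqNgt py.
move=> q qM pq; rewrite ltnNge; apply/negP => qp.
by have := pairing_unpaired qM pU qp; lia.
Qed.

End Word.

(** * Raising operators on tableaux *)

Lemma occ_cat x s1 s2 : occ x (s1 ++ s2) = occ x s1 + occ x s2.
Proof. exact: count_cat. Qed.

Lemma occ_rev x s : occ x (rev s) = occ x s.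
Proof. exact: count_rev. Qed.

Lemma take_flatten (ss : seq (seq nat)) k d : d <= size (nth [::] ss k) ->
  take (size (flatten (take k ss)) + d) (flatten ss) =
  flatten (take k ss) ++ take d (nth [::] ss k).
Proof.
elim: ss k => [|s ss IH] [|k] //= hd; first by rewrite add0n takel_cat.
rewrite size_cat -addnA -catA -IH // take_cat ifN; last by rewrite -leqNgt leq_addr.
by rewrite addKn.
Qed.

Lemma flatten_position (ss : seq (seq nat)) p : p < size (flatten ss) ->
  exists k d, [/\ k < size ss, d < size (nth [::] ss k),
    p = size (flatten (take k ss)) + d,
    nth 0 (flatten ss) p = nth 0 (nth [::] ss k) d
  & forall v, reshape (shape ss) (set_nth 0 (flatten ss) p v) =
              set_nth [::] ss k (set_nth 0 (nth [::] ss k) d v)].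
Proof.
elim: ss p => //= s ss IH p; rewrite size_cat => hp.
have [ps|sp] := ltnP p (size s).
  exists 0, p; split=> //=; first by rewrite nth_cat ps.
  move=> v; have -> : set_nth 0 (s ++ flatten ss) p v = set_nth 0 s p v ++ flatten ss.
    by elim: s p ps {hp} => [|x s IHs] [|p] //= /IHs ->.
  have sz : size s = size (set_nth 0 s p v) by rewrite size_set_nth; lia.
  by rewrite {1 2}sz take_size_cat // drop_size_cat // flattenK.
have [|k [d [kss ds def_p nthp eq_res]]] := IH (p - size s); first lia.
exists k.+1, d; split=> //=; first by rewrite size_cat; lia.
  by rewrite nth_cat ltnNge sp /= nthp.
move=> v; have -> : set_nth 0 (s ++ flatten ss) p v = s ++ set_nth 0 (flatten ss) (p - size s) v.
  elim: s p sp {hp IH nthp eq_res def_p} => [|x s IHs] [|p] //=.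
  by rewrite ltnS subSS => /IHs ->.
by rewrite take_size_cat // drop_size_cat // eq_res.
Qed.

Lemma sorted_split x (s : seq nat) : sorted leq s ->
  s = [seq y <- s | y <= x] ++ [seq y <- s | x < y].
Proof.
elim: s => //= y s IH ys; have /IH{}IH := path_sorted ys.
case: (leqP y x) => yx /=; first by rewrite -IH.
have all_s : all (fun z => x < z) s.
  apply/allP => z; have /allP/(_ z) := order_path_min leq_trans ys.
  by move=> H /H; apply: leq_trans.
rewrite [filter (fun _ => _ <= x) s](_ : _ = [::]) /=.
  by congr (_ :: _); apply/esym/all_filterP.
by apply/eqP; rewrite -[_ == _]negbK -has_filter -all_predC; apply: sub_all all_s => z /=;
  rewrite ltnNge.
Qed.

Lemma take_rev_sorted x (s : seq nat) : sorted leq s ->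
  take (count (fun y => x < y) s) (rev s) = rev [seq y <- s | x < y].
Proof.
move=> /(sorted_split x) {2}->; rewrite rev_cat -size_filter.
by rewrite take_size_cat ?size_rev.
Qed.

Definition row_occ (x : nat) (T : tableau) (k : nat) : nat := occ x (flatten (take k T)).

Lemma row_occS x T k : row_occ x T k.+1 = row_occ x T k + occ x (nth [::] T k).
Proof.
rewrite /row_occ; elim: T k => [|s T IH] [|k] //=; first by rewrite take0 cats0.
by rewrite !occ_cat IH addnA.
Qed.

Lemma row_occ_rev x T k : row_occ x (map rev T) k = row_occ x T k.
Proof.
rewrite /row_occ; elim: T k => [|s T IH] [|k] //=.
by rewrite !occ_cat IH occ_rev.
Qed.

Lemma nth_map_rev (T : tableau) k : nth [::] (map rev T) k = rev (nth [::] T k).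
Proof.
have [kT|Tk] := ltnP k (size T); first exact: nth_map.
by rewrite !nth_default ?size_map.
Qed.

Definition entry (T : tableau) (p c : nat) : nat := nth 0 (nth [::] T p) c.

(** A row is read from right to left, so its letters above i come before its letters i; the prefix
    stops between them in row q. *)
Lemma row_prefix i (T : tableau) q : all (sorted leq) T -> exists2 t,
    occ i.+1 (take t (flatten (map rev T))) = row_occ i.+1 T q.+1 /\
    occ i (take t (flatten (map rev T))) = row_occ i T q
  & t <= size (flatten (take q.+1 (map rev T))).
Proof.
move=> sT; pose s := nth [::] T q; pose d := count (fun y => i < y) s.
have ss : sorted leq s.
  have [qT|Tq] := ltnP q (size T); last by rewrite /s nth_default.
  by apply: (allP sT); apply: mem_nth.
have ds : d <= size (nth [::] (map rev T) q) by rewrite nth_map_rev size_rev count_size.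
exists (size (flatten (take q (map rev T))) + d).
  rewrite take_flatten // !occ_cat -!/(row_occ _ _ _) !row_occ_rev nth_map_rev.
  rewrite -/s take_rev_sorted // !occ_rev row_occS -/s; split.
    by rewrite /occ count_filter; congr (_ + _); apply: eq_count => y /=; lia.
  rewrite /occ count_filter -[RHS]addn0; congr (_ + _).
  by rewrite -(count_pred0 s); apply: eq_count => y /=; lia.
clearbody d; clear s ss; elim: (map rev T) q ds => [|s ss IH] [|q] //=; rewrite ?take0 ?cats0 //.
by rewrite !size_cat -addnA leq_add2l; apply: IH.
Qed.

Lemma map_rev_set_nth (ss : seq (seq nat)) p r : p < size ss ->
  map rev (set_nth [::] ss p r) = set_nth [::] (map rev ss) p (rev r).
Proof. by elim: ss p => [|s ss IH] [|p] //= /IH ->. Qed.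

Lemma tableau_raise_None i T : all (sorted leq) T -> tableau_raise i T = None ->
  forall q, row_occ i.+1 T q.+1 <= row_occ i T q.
Proof.
move=> sT; rewrite /tableau_raise; case E: word_raise => // _ q.
have [t [<- <-] _] := row_prefix i q sT.
exact: word_raise_None E t.
Qed.

Lemma rev_set_nth (s : seq nat) d v : d < size s ->
  rev (set_nth 0 (rev s) d v) = set_nth 0 s (size s - d.+1) v.
Proof.
move=> ds; apply: (@eq_from_nth _ 0).
  by rewrite size_rev !size_set_nth size_rev; lia.
move=> c; rewrite size_rev size_set_nth size_rev => hc.
have {}hc : c < size s by lia.
rewrite nth_rev size_set_nth size_rev (maxn_idPr ds); last by [].
rewrite !nth_set_nth /= nth_rev; last by lia.
have -> : (size s - c.+1 == d) = (c == size s - d.+1) by apply/eqP/eqP; lia.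
by case: eqP => // _; congr nth; lia.
Qed.

Lemma tableau_raise_Some i T T' :
  all (sorted leq) T -> tableau_raise i T = Some T' ->
  exists p k, [/\ p < size T, k < size (nth [::] T p), entry T p k = i.+1,
     T' = set_nth [::] T p (set_nth 0 (nth [::] T p) k i)
   & [/\ forall c, c < k -> entry T p c != i.+1,
         forall q, row_occ i.+1 T q.+1 + row_occ i T p <= row_occ i.+1 T p.+1 + row_occ i T q
       & forall q, q < p ->
         row_occ i.+1 T q.+1 + row_occ i T p < row_occ i.+1 T p.+1 + row_occ i T q]].
Proof.
move=> sT; rewrite /tableau_raise; case E: word_raise => [w'|//] [<-].
have [x [xw nx -> ltx lex]] := word_raise_Some E.
have [p [d [pT]]] := flatten_position xw; rewrite size_map in pT.
rewrite nth_map_rev size_rev => ds def_x nth_x res_x.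
set s := nth [::] T p in ds nth_x res_x *.
have take_x : take x.+1 (flatten (map rev T)) =
    flatten (take p (map rev T)) ++ take d.+1 (rev s).
  by rewrite def_x -addnS take_flatten nth_map_rev ?size_rev.
have occ_x y : occ y (take x.+1 (flatten (map rev T))) =
    row_occ y T p + occ y (take d.+1 (rev s)).
  by rewrite take_x occ_cat -/(row_occ _ _ _) row_occ_rev.
have occ_s y : occ y s = occ y (take d.+1 (rev s)) + occ y (drop d.+1 (rev s)).
  by rewrite -occ_cat cat_take_drop occ_rev.
(* The prefix with all letters i+1 and no letter i of row p cannot exceed the maximum, so row p has
   no i read before the changed letter and no i+1 read after it. *)
have [t [t1 t2] _] := row_prefix i p sT.
have := lex t; rewrite t1 t2 !occ_x row_occS -/s => le_p.
have occi0 : occ i (take d.+1 (rev s)) = 0 by have := occ_s i.+1; lia.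
have occi1 : occ i.+1 (drop d.+1 (rev s)) = 0 by have := occ_s i.+1; lia.
exists p, (size s - d.+1); split=> //; first by rewrite -/s; lia.
- by rewrite /entry -/s -nth_rev // -nx nth_x.
- have -> : shape T = shape (map rev T).
    by rewrite /shape -map_comp; apply: eq_map => r /=; rewrite size_rev.
  rewrite res_x map_rev_set_nth ?size_map // rev_set_nth //.
  by rewrite mapK //; apply: revK.
split.
- move=> c hc; have hs : size s - c.+1 - d.+1 < size s - d.+1 by lia.
  have hd : d.+1 + (size s - c.+1 - d.+1) = size s - c.+1 by lia.
  have hr : size s - c.+1 < size s by lia.
  have hc' : size s - (size s - c.+1).+1 = c by lia.
  apply/eqP => ec; move/eqP: occi1; apply/negP.
  rewrite /occ -lt0n -has_count has_pred1; apply/(nthP 0).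
  exists (size s - c.+1 - d.+1); first by rewrite size_drop size_rev.
  by rewrite nth_drop hd nth_rev // hc' -ec.
- move=> q; have [tq [q1 q2] _] := row_prefix i q sT.
  have := lex tq; rewrite q1 q2 !occ_x (row_occS _ _ p) -/s.
  by have := occ_s i.+1; lia.
move=> q qp; have [tq [q1 q2] letq] := row_prefix i q sT.
have tqx : tq <= x.
  apply: leq_trans letq _; rewrite def_x; apply: leq_trans (leq_addr _ _).
  rewrite -(cat_take_drop q.+1 (take p (map rev T))) flatten_cat size_cat take_takel //.
  exact: leq_addr.
have := ltx _ tqx; rewrite q1 q2 !occ_x (row_occS _ _ p) -/s.
by have := occ_s i.+1; lia.
Qed.

Lemma sum_ltn m q : \sum_(0 <= p < m) (p < q) = minn m q.
Proof.
elim: m => [|m IH]; first by rewrite big_geq ?min0n.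
by rewrite big_nat_recr //= IH; lia.
Qed.

(** * Semistandard tableaux by columns, and the column reading *)

Section Columns.

Variables (n : nat) (lam : n.-tuple nat).
Hypothesis lamP : is_partition lam.

Notation L p := (nth 0 lam p).

Lemma part_le p q : p <= q -> L q <= L p.
Proof.
move=> pq; have [qn|nq] := ltnP q n; last by rewrite nth_default ?size_tuple.
have tr : transitive geq by move=> x y z /= yx xz; apply: leq_trans xz yx.
by apply: (sorted_leq_nth tr (leqnn : reflexive geq) 0 lamP); rewrite ?inE ?size_tuple //;
  apply: leq_ltn_trans qn.
Qed.

Lemma part_lt p c : c < L p -> p < n.
Proof. by case: (ltnP p n) => // np; rewrite nth_default ?size_tuple. Qed.

Section Shape.

Variable T : tableau.
Hypothesis shT : shape T = lam.

Lemma size_row p : size (nth [::] T p) = L p.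
Proof.
rewrite -shT; have [pT|Tp] := ltnP p (size T); first by rewrite (nth_map [::]).
by rewrite !nth_default ?size_map.
Qed.

Lemma size_rows : size T = n.
Proof. by rewrite -(size_map size T) -/(shape T) shT size_tuple. Qed.

End Shape.

Lemma ssytP T : ssyt lam T <->
  [/\ shape T = lam, forall p c, c < L p -> entry T p c < n,
      forall p c c', c <= c' -> c' < L p -> entry T p c <= entry T p c'
    & forall p c, c < L p.+1 -> entry T p c < entry T p.+1 c].
Proof.
split=> [/and4P[/eqP shT /allP entT /allP rowT colT]|[shT entT rowT colT]].
  have szT := size_rows shT; have szr := size_row shT.
  have inT p : p < n -> nth [::] T p \in T by move=> pn; rewrite mem_nth ?szT.
  split=> // [p c cp|p c c' cc' cp|p c cp].
  - apply: (allP (entT _ (inT p _))); first exact: part_lt cp.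
    by rewrite mem_nth ?szr.
  - have pn := part_lt cp.
    apply: (sorted_leq_nth leq_trans leqnn 0 (rowT _ (inT p pn))) => //;
      rewrite inE szr //; exact: leq_ltn_trans cp.
  have pn := part_lt cp; have cp' : c < L p by apply: leq_trans (part_le (leqnSn p)).
  have cz : c < size (zip (nth [::] T p) (nth [::] T p.+1)).
    by rewrite size_zip !szr leq_min cp'.
  move/(sortedP [::])/(_ p) : colT; rewrite szT => /(_ pn) /(all_nthP (0, 0)) /(_ c cz).
  by rewrite nth_zip_cond cz.
have szT := size_rows shT; have szr := size_row shT.
apply/and4P; split; first exact/eqP.
- apply/(all_nthP [::]) => p pT; apply/(all_nthP 0) => c; rewrite szr; exact: entT.
- apply/(all_nthP [::]) => p pT; apply/(sortedP 0) => c; rewrite szr => cp.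
  exact: (rowT p c c.+1).
- apply/(sortedP [::]) => p pT; apply/(all_nthP (0, 0)) => c cz.
  rewrite nth_zip_cond cz /=; apply: colT.
  by move: cz; rewrite size_zip !szr leq_min => /andP[].
Qed.

Lemma entry_strict T p q c : ssyt lam T -> p < q -> c < L q -> entry T p c < entry T q c.
Proof.
move=> /ssytP[_ _ _ colT]; elim: q => // q IH; rewrite ltnS leq_eqVlt => /predU1P[->|pq] cq.
  exact: colT.
by apply: ltn_trans (colT _ _ cq); apply: IH => //; apply: leq_trans (part_le (leqnSn q)).
Qed.

(* As a function of b, it determines column c of a semistandard tableau. *)
Definition below (T : tableau) (c b : nat) : nat :=
  \sum_(0 <= p < n) ((c < L p) && (entry T p c < b)).

(** Columns increase strictly, so the entries smaller than b fill the top of the column. *)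
Lemma entry_lt_below T p c b : ssyt lam T -> c < L p ->
  (entry T p c < b) = (p < below T c b).
Proof.
move=> sT cp; have pn := part_lt cp; apply/idP/idP => [eb|].
  have -> : p.+1 = \sum_(0 <= q < n) (q < p.+1) by rewrite sum_ltn; lia.
  apply: leq_sum => q _; case: (ltnP q p.+1) => // qp.
  rewrite (leq_trans cp (part_le _)) //; case: (ltngtP q p) => [qp'|//|->]; last by rewrite eb.
    by rewrite (ltn_trans (entry_strict sT qp' cp) eb).
  lia.
apply: contraTT; rewrite -!leqNgt => be.
have ep : p = \sum_(0 <= q < n) (q < p) by rewrite sum_ltn; lia.
rewrite [X in _ <= X]ep.
apply: leq_sum => q _; case: (ltnP q p) => [_|pq]; first exact: leq_b1.
case: (ltnP c (L q)) => //= cq; rewrite ltnNge.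
move: pq; rewrite leq_eqVlt => /predU1P[<-|pq]; first by rewrite be.
by rewrite (leq_trans be) // ltnW // entry_strict.
Qed.

Lemma below_inj T T' : ssyt lam T -> ssyt lam T' ->
  (forall c b, below T c b = below T' c b) -> T = T'.
Proof.
move=> sT sT' eqb; have [shT _ _ _] := (ssytP T).1 sT; have [shT' _ _ _] := (ssytP T').1 sT'.
apply: (@eq_from_nth _ [::]) => [|p _]; first by rewrite (size_rows shT) (size_rows shT').
apply: (@eq_from_nth _ 0) => [|c]; first by rewrite (size_row shT) (size_row shT').
rewrite (size_row shT) => cp; rewrite -!/(entry _ _ _).
have eq_lt b : (entry T p c < b) = (entry T' p c < b).
  by rewrite !entry_lt_below // eqb.
by have := eq_lt (entry T p c).+1; have := eq_lt (entry T' p c).+1; lia.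
Qed.

(** The parts of the conjugate partition. *)
Definition col_len (c : nat) : nat := \sum_(0 <= p < n) (c < L p).

Definition col_occ (x : nat) (T : tableau) (c : nat) : nat :=
  \sum_(0 <= p < n) ((c < L p) && (entry T p c == x)).

Lemma belowS T c b : below T c b.+1 = below T c b + col_occ b T c.
Proof.
clear lamP; rewrite /below /col_occ -big_split; apply: eq_bigr => p _ /=.
by case: (c < L p) => //=; case: (ltngtP (entry T p c) b) => h //=; lia.
Qed.

Lemma below_len T c b : below T c b <= col_len c.
Proof. by apply: leq_sum => p _; case: (c < L p) => //=; apply: leq_b1. Qed.

Lemma lt_col_len p c : (p < col_len c) = (c < L p).
Proof.
apply/idP/idP => [|cp].
  apply: contraTT; rewrite -!leqNgt => Lc.
  have ep : minn n p <= p by lia.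
  apply: leq_trans ep; rewrite -sum_ltn; apply: leq_sum => q _.
  by case: (ltnP q p) => [_|/part_le pq]; [exact: leq_b1 | rewrite ltnNge (leq_trans pq Lc)].
have -> : p.+1 = \sum_(0 <= q < n) (q < p.+1) by rewrite sum_ltn; have := part_lt cp; lia.
apply: leq_sum => q _; case: (ltnP q p.+1) => // qp.
by rewrite (leq_trans cp (part_le _)).
Qed.

Definition row_from (x : nat) (T : tableau) (p c : nat) : nat :=
  \sum_(c <= c' < L 0) ((c' < L p) && (entry T p c' == x)).

(** The letters x in a prefix of the column reading, which takes columns from right to left and ends
    here with column c. *)
Definition col_from (x : nat) (T : tableau) (c : nat) : nat :=
  \sum_(c <= c' < L 0) col_occ x T c'.

Lemma col_fromS x T c : col_from x T c = col_occ x T c + col_from x T c.+1.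
Proof.
rewrite /col_from; have [cL|Lc] := ltnP c (L 0); first by rewrite big_ltn.
rewrite !big_geq ?(leq_trans Lc) // addn0 /col_occ big1 // => p _.
by rewrite ltnNge (leq_trans (part_le (leq0n p)) Lc).
Qed.

Lemma col_from_rows x T c m : n <= m ->
  col_from x T c = \sum_(0 <= p < m) row_from x T p c.
Proof.
move=> nm; rewrite /col_from /col_occ exchange_big /= [RHS](big_cat_nat (n := n)) //=.
rewrite [X in _ = _ + X]big_nat_cond [X in _ = _ + X]big1 ?addn0 // => p /andP[/andP[np _] _].
rewrite /row_from big1 // => c' _.
by rewrite [L p]nth_default ?size_tuple.
Qed.

Lemma occ_row x T p : shape T = lam -> occ x (nth [::] T p) = row_from x T p 0.
Proof.
move=> shT; have := size_row shT p; rewrite /row_from /entry.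
move: (nth [::] T p) => s szs; have sL : size s <= L 0 by rewrite szs part_le.
rewrite -szs (big_cat_nat (n := size s)) //= [X in _ = _ + X]big_nat_cond.
rewrite [X in _ = _ + X]big1 ?addn0; last first.
  by move=> c /andP[/andP[sc _] _]; rewrite ltnNge sc.
rewrite /occ -sum1_count big_mkcond [LHS](big_nth 0).
by apply: eq_big_nat => c /andP[_ ->] /=; case: eqP.
Qed.

Lemma row_occ_sum x T k : shape T = lam ->
  row_occ x T k = \sum_(0 <= p < k) row_from x T p 0.
Proof.
move=> shT; elim: k => [|k IH]; first by rewrite /row_occ take0 big_geq.
by rewrite row_occS IH big_nat_recr //= occ_row.
Qed.

Lemma row_from_le x T p c c' : c <= c' -> row_from x T p c' <= row_from x T p c.
Proof.
rewrite /row_from => cc'; have [cL|Lc] := leqP c' (L 0); last by rewrite (big_geq (ltnW Lc)).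
by rewrite [X in _ <= X](big_cat_nat (n := c')) //= leq_addl.
Qed.

Lemma row_from_full x T p c : (forall c', c' < c -> c' < L p -> entry T p c' != x) ->
  row_from x T p c = row_from x T p 0.
Proof.
move=> H; rewrite /row_from; have [cL|Lc] := leqP c (L 0).
  rewrite [RHS](big_cat_nat (n := c)) //= [X in _ = X + _]big_nat_cond.
  rewrite [X in _ = X + _]big1 // => c' /andP[/andP[_ c'c] _].
  by case: (ltnP c' (L p)) => //= /(H _ c'c)/negbTE ->.
rewrite (big_geq (ltnW Lc)) big_nat_cond big1 // => c' /andP[/andP[_ c'L] _].
by case: (ltnP c' (L p)) => //= /(H _ (ltn_trans c'L Lc))/negbTE ->.
Qed.

Lemma row_from_eq0 x T p c : (forall c', c <= c' -> c' < L p -> entry T p c' != x) ->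
  row_from x T p c = 0.
Proof.
move=> H; rewrite /row_from big_nat_cond big1 // => c' /andP[/andP[cc' _] _].
by case: (ltnP c' (L p)) => //= /(H _ cc')/negbTE ->.
Qed.

(** The entry above a letter i+1 of row p+1 is at most i, and at least i because row p increases
    weakly from column c on. *)
Lemma row_from_below i T p c : ssyt lam T ->
  (c < L p -> i <= entry T p c) -> row_from i.+1 T p.+1 c <= row_from i T p c.
Proof.
move=> sT ic; have [_ _ rowT colT] := (ssytP T).1 sT.
rewrite /row_from big_nat [X in _ <= X]big_nat; apply: leq_sum => c' /andP[cc' _]; case: (ltnP c' (L p.+1)) => //= c'p.
case: eqP => //= ec'; have := colT _ _ c'p; rewrite ec' ltnS.
have c'p' := leq_trans c'p (part_le (leqnSn p)); rewrite c'p' /= => h.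
have := ic (leq_ltn_trans cc' c'p'); have := rowT _ _ _ cc' c'p'.
by lia.
Qed.

(* Compares the column reading at column c with the row reading after the
   letters i+1 of row q, where q is the first row with entry at least i in
   column c: the letters i+1 of row q+1 counted on the left lie below letters i
   of row q which the right-hand side does not count. *)
Lemma col_from_row_occ i T c (q := below T c i) : ssyt lam T ->
  col_from i.+1 T c + row_occ i T q + row_from i.+1 T q 0 <=
  row_occ i.+1 T q.+1 + col_from i T c + row_from i.+1 T q c.
Proof.
move=> sT; have [shT _ rowT colT] := (ssytP T).1 sT.
pose m := (n + q).+2; have nm : n <= m by lia.
rewrite !(col_from_rows _ _ _ nm) !row_occ_sum //.
have above p x : p < q -> i <= x -> row_from x T p c = row_from x T p 0.
  move=> pq ix; apply: row_from_full => c' c'c c'p; apply/eqP => ec'.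
  have cp : c < L p by rewrite -lt_col_len (leq_trans pq) // below_len.
  have := rowT _ _ _ (ltnW c'c) cp.
  by move: pq; rewrite -entry_lt_below // ec'; lia.
have ge_q p : q <= p -> c < L p -> i <= entry T p c.
  by move=> qp cp; rewrite leqNgt entry_lt_below // -leqNgt.
have far p : q.+2 <= p -> row_from i.+1 T p c = 0.
  case: p => [//|[//|p]]; rewrite !ltnS => qp; apply: row_from_eq0 => c' cc' c'p.
  have cp := leq_ltn_trans cc' c'p.
  have := rowT _ _ _ cc' c'p; have := colT _ _ cp.
  have cp1 := leq_trans cp (part_le (leqnSn p.+1)).
  have := colT _ _ cp1; have := ge_q _ qp (leq_trans cp1 (part_le (leqnSn p))).
  by lia.
rewrite (big_cat_nat (n := q) (p := m)) //=; last by lia.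
rewrite [X in _ <= _ + X + _](big_cat_nat (n := q)) //=; last by lia.
rewrite [X in _ + X + _ + _ <= _]big_ltn; last by lia.
rewrite [X in _ + (_ + X) + _ + _ <= _]big_ltn; last by lia.
rewrite [X in _ + (_ + (_ + X)) + _ + _ <= _]big_nat_cond.
rewrite [X in _ + (_ + (_ + X)) + _ + _ <= _]big1; last first.
  by move=> p /andP[/andP[/far]].
rewrite [X in _ <= _ + (_ + X) + _]big_ltn; last by lia.
rewrite [X in _ <= X + _ + _]big_nat_recr //=.
have eq_sum x : i <= x -> \sum_(0 <= p < q) row_from x T p c = \sum_(0 <= p < q) row_from x T p 0.
  by move=> ix; apply: eq_big_nat => p /andP[_ pq]; apply: above.
rewrite !eq_sum //; have := row_from_below sT (ge_q q (leqnn q)); lia.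
Qed.

(** If each letter i+1 of row p+1 has a letter i above it, passing to row p+1 cannot increase the
    excess. This excludes a letter i directly above the cell changed by e_i. *)
Lemma occ_row_below i T p : ssyt lam T ->
  (forall c, c < L p.+1 -> entry T p.+1 c = i.+1 -> i <= entry T p c) ->
  row_occ i.+1 T p.+2 + row_occ i T p <= row_occ i.+1 T p.+1 + row_occ i T p.+1.
Proof.
move=> sT H; have [shT _ _ colT] := (ssytP T).1 sT.
rewrite (row_occS _ _ p.+1) (row_occS i) !occ_row //.
suff : row_from i.+1 T p.+1 0 <= row_from i T p 0 by lia.
apply: leq_sum => c _; case: (ltnP c (L p.+1)) => //= cp; case: eqP => // ec.
by have := H _ cp ec; have := colT _ _ cp; rewrite ec (leq_trans cp (part_le (leqnSn p))) /=; lia.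
Qed.

Lemma entry_set_nth T p k i q c : shape T = lam -> k < L p ->
  entry (set_nth [::] T p (set_nth 0 (nth [::] T p) k i)) q c =
  if (q == p) && (c == k) then i else entry T q c.
Proof.
move=> shT kp; rewrite /entry nth_set_nth /=; case: eqP => //= ->.
by rewrite nth_set_nth /=; case: eqP.
Qed.

Lemma shape_set_nth T p k i : shape T = lam -> k < L p ->
  shape (set_nth [::] T p (set_nth 0 (nth [::] T p) k i)) = lam.
Proof.
move=> shT kp; rewrite -shT; apply: (@eq_from_nth _ 0).
  rewrite !size_map size_set_nth; apply/maxn_idPr.
  by rewrite (size_rows shT) (part_lt kp).
move=> q; rewrite size_map => qs; rewrite !(nth_map [::]) //; last first.
  by move: qs; rewrite size_set_nth (size_rows shT); have := part_lt kp; lia.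
rewrite nth_set_nth /=; case: eqP => // ->.
by rewrite size_set_nth; apply/maxn_idPr; rewrite (size_row shT).
Qed.

(* k is the column changed by e_i.  In the column reading, from right to left,
   it is where the excess of letters i+1 over letters i first becomes maximal. *)
Lemma ssyt_raise_Some i T T' : ssyt lam T -> tableau_raise i T = Some T' ->
  ssyt lam T' /\ exists k : nat,
  [/\ forall c b, below T' c b = below T c b + ((c == k) && (b == i.+1)),
      forall c, col_from i.+1 T c + col_from i T k <= col_from i.+1 T k + col_from i T c
    & forall c, k < c ->
        col_from i.+1 T c + col_from i T k < col_from i.+1 T k + col_from i T c].
Proof.
move=> sT; have [shT entT rowT colT] := (ssytP T).1 sT.
have sorT : all (sorted leq) T by case/and4P: sT.
case/(tableau_raise_Some sorT) => p [k [pT kp ek def_T' [left_k max_p first_p]]].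
rewrite (size_row shT) in kp; have pn := part_lt kp.
have left_lt c : c < k -> entry T p c <= i.
  by move=> ck; have := left_k _ ck; have := rowT _ _ _ (ltnW ck) kp; rewrite ek; lia.
have entT' q c : entry T' q c = if (q == p) && (c == k) then i else entry T q c.
  by rewrite def_T' entry_set_nth.
split.
  apply/ssytP; split.
  - by rewrite def_T' shape_set_nth.
  - move=> q c cq; rewrite entT'; case: ifP => _; last exact: entT.
    by have := entT _ _ kp; rewrite ek; lia.
  - move=> q c c' cc' c'q; rewrite !entT'; have := rowT _ _ _ cc' c'q.
    case: (q =P p) => //= eq; rewrite {}eq in c'q *.
    case: (c =P k) => ck; case: (c' =P k) => c'k //=; rewrite ?ck ?c'k ?ek; try lia.
    by move=> _; apply: left_lt; lia.
  move=> q c cq; rewrite !entT'; have := colT _ _ cq.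
  case: (c =P k) cq => [->|_] cq; rewrite ?andbF // !andbT.
  case: (q =P p) => [->|_]; first by rewrite (gtn_eqF (ltnSn p)) ek; lia.
  case: (q.+1 =P p) => [eqp|//].
  rewrite -{}eqp in ek kp left_lt first_p; rewrite ek ltnS leq_eqVlt.
  (* A letter i above the changed cell forces entries at least i above all letters i+1 of row p, so
     row p-1 would already reach the maximal excess. *)
  case/predU1P => // eqi; have := first_p _ (ltnSn q).
  rewrite ltnNge => /negP[]; apply: occ_row_below => // c' cp ec.
  have [ck|kc] := ltnP c' k; first by have := left_lt _ ck; lia.
  rewrite -eqi; apply: rowT => //; exact: leq_trans cp (part_le (leqnSn q)).
(* Rows up to p have all their letters i+1 weakly right of column k, and rows from p on have no
   letter i there; so the column excess at k is at least the maximal row excess. *)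
have kL : col_from i.+1 T k + row_occ i T p >= row_occ i.+1 T p.+1 + col_from i T k.
  rewrite !(col_from_rows _ _ _ (leqnn n)) !row_occ_sum //; apply: leq_add.
    rewrite [X in _ <= X](big_cat_nat (n := p.+1)) //=; apply: leq_trans (leq_addr _ _).
    rewrite big_nat [X in _ <= X]big_nat; apply: leq_sum => q /=; rewrite ltnS => qp.
    rewrite [X in _ <= X]row_from_full // => c ck _; apply/eqP => ec.
    move: qp; rewrite leq_eqVlt => /predU1P[eqp|qp].
      by move: (left_k _ ck); rewrite -eqp ec eqxx.
    have := entry_strict sT qp kp; rewrite ek ltnS => h.
    by have := rowT q _ _ (ltnW ck) (leq_trans kp (part_le (ltnW qp))); rewrite ec; lia.
  rewrite (big_cat_nat (n := p)) //=; last by lia.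
  rewrite [X in _ + X <= _]big_nat_cond [X in _ + X <= _]big1 ?addn0.
    by apply: leq_sum => q _; apply: row_from_le.
  move=> q /andP[/andP[pq _] _]; apply: row_from_eq0 => c kc cq; apply/eqP => ec.
  have := rowT _ _ _ kc cq; have kq := leq_ltn_trans kc cq; rewrite ec.
  move: pq; rewrite leq_eqVlt => /predU1P[<-|pq]; first by rewrite ek; lia.
  by have := entry_strict sT pq kq; rewrite ek; lia.
exists k; split.
- move=> c b; rewrite /below.
  have -> : \sum_(0 <= q < n) ((c < L q) && (entry T' q c < b)) =
     \sum_(0 <= q < n) (((c < L q) && (entry T q c < b)) +
        [&& q == p, c == k & b == i.+1]).
    apply: eq_bigr => q _; rewrite entT'; case: (q =P p) => [->|_] /=; last by rewrite addn0.
    case: (c =P k) => [->|_] /=; last by rewrite addn0.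
    by rewrite kp ek /=; case: (ltngtP b i.+1); lia.
  rewrite big_split; congr (_ + _); rewrite (bigD1_seq p) ?mem_index_iota ?iota_uniq //=.
  by rewrite eqxx big1 ?addn0 // => q /negbTE ->.
- move=> c; have := col_from_row_occ i c sT; have := max_p (below T c i).
  have := row_from_le i.+1 T (below T c i) (leq0n c); lia.
(* The row q compared with column c is weakly above row p. If it is row p, strictness comes from the
   letter i+1 in column k, which column c no longer counts; otherwise from [first_p]. *)
move=> c kc; have := col_from_row_occ i c sT; set q := below T c i.
have := row_from_le i.+1 T q (leq0n c).
have : q <= p.
  rewrite leqNgt; apply/negP => pq.
  have cp : c < L p by rewrite -lt_col_len (leq_trans pq) // below_len.
  by move: pq; have := rowT _ _ _ (ltnW kc) cp; rewrite -entry_lt_below // ek; lia.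
rewrite leq_eqVlt => /predU1P[->|/first_p]; last by lia.
suff : row_from i.+1 T p c < row_from i.+1 T p 0 by lia.
rewrite -(row_from_full (x := i.+1) (T := T) (p := p) (c := k)); last by move=> c' c'k _; apply: left_k.
apply: (@leq_ltn_trans (row_from i.+1 T p k.+1)); first exact: row_from_le.
by rewrite /row_from [X in _ < X]big_ltn ?kp ?ek ?eqxx // (leq_trans kp) // part_le.
Qed.

Lemma ssyt_raise_None i T c : ssyt lam T -> tableau_raise i T = None ->
  col_from i.+1 T c <= col_from i T c.
Proof.
move=> sT; have sorT : all (sorted leq) T by case/and4P: sT.
move=> /(tableau_raise_None sorT)/(_ (below T c i)).
have := col_from_row_occ i c sT.
by have := row_from_le i.+1 T (below T c i) (leq0n c); lia.
Qed.

End Columns.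

(** * Bruhat order *)

Section Rank.

Variable n : nat.
Implicit Types (x y z : 'S_n) (a b : nat) (i : 'I_n.-1).

Local Open Scope group_scope.

Definition rank x a b : nat := #|[set p : 'I_n | (p < a) && (x p < b)]|.

Lemma rankV x a b : rank x^-1 b a = rank x a b.
Proof.
rewrite /rank -(card_imset _ (@perm_inj _ x^-1)); congr #|pred_of_set _|.
apply/setP => p; rewrite -[in LHS](permK x p) mem_imset; last exact: perm_inj.
by rewrite !inE permK andbC.
Qed.

Lemma rankS x (p : 'I_n) b : rank x p.+1 b = rank x p b + (x p < b).
Proof.
rewrite /rank; have [xb|bx] := ltnP (x p) b.
  rewrite (_ : [set q : 'I_n | (q < p.+1) && (x q < b)] =
               p |: [set q : 'I_n | (q < p) && (x q < b)]).
    by rewrite cardsU1 inE ltnn addnC.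
  apply/setP => q; rewrite !inE ltnS leq_eqVlt andb_orl; congr (_ || _).
  by rewrite -val_eqE /=; case: eqP => //= /val_inj ->.
rewrite addn0; congr #|pred_of_set _|; apply/setP => q; rewrite !inE ltnS leq_eqVlt.
by case: eqP => //= /val_inj ->; rewrite ltnNge bx andbF.
Qed.

Definition place x (v : 'I_n) : nat := x^-1 v.

Lemma place_inj x v v' : place x v = place x v' -> v = v'.
Proof. by move=> /val_inj /perm_inj. Qed.

Lemma rankSr x a (q : 'I_n) : rank x a q.+1 = rank x a q + (place x q < a).
Proof. by rewrite -!(rankV x) rankS. Qed.

Lemma rank0l x b : rank x 0 b = 0.
Proof. by apply/eqP; rewrite cards_eq0 -subset0; apply/subsetP => p; rewrite !inE. Qed.

Lemma rank_le x a b : rank x a b <= b.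
Proof.
rewrite -rankV; elim: b => [|b IH]; first by rewrite rank0l.
have [bn|nb] := ltnP b n; first by rewrite (rankS x^-1 (Ordinal bn)) /=; lia.
apply: leq_trans (leqW IH); apply: subset_leq_card; apply/subsetP => p.
by rewrite !inE => /andP[_ ->]; rewrite (leq_trans (ltn_ord p)).
Qed.

Lemma rank_n x b : b <= n -> rank x n b = b.
Proof.
elim: b => [|b IH] bn; first by rewrite -rankV rank0l.
by rewrite (rankSr x n (Ordinal bn)) /= IH ?ltn_ord ?addn1 // ltnW.
Qed.

Lemma rank_1 a b : a <= n -> rank 1 a b = minn a b.
Proof.
elim: a => [|a IH] an; first by rewrite rank0l min0n.
have := rankS 1 (Ordinal an) b; rewrite perm1 /= => ->; rewrite IH; lia.
Qed.

(* The Bruhat order, by the rank criterion. *)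
Definition rank_order x y : Prop := forall a b, rank y a b <= rank x a b.

Lemma rank_order_refl x : rank_order x x. Proof. by []. Qed.

Lemma rank_order_trans y x z : rank_order x y -> rank_order y z -> rank_order x z.
Proof. by move=> xy yz a b; apply: leq_trans (xy a b). Qed.

(** The ranks at (p+1, p+1) force x p <= p for all p, and only the identity has this property. *)
Lemma rank_order1 x : rank_order x 1 -> x = 1.
Proof.
move=> x1; suff xle p : x p <= p.
  have sub (q : 'I_n) : x q = q.
    elim/ltn_ind: {q}(q : nat) {-2}q (erefl (q : nat)) => m IH q qm.
    have := xle q; rewrite leq_eqVlt => /predU1P[/val_inj //|xq].
    have := IH (x q) _ (x q) erefl; rewrite -qm => /(_ xq) /perm_inj eq.
    by rewrite eq.
  by apply/permP => q; rewrite perm1.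
have := x1 p.+1 p.+1; rewrite rank_1 ?ltn_ord // minnn rankS.
by have := rank_le x^-1 p.+1 p; rewrite rankV; lia.
Qed.

Definition lo i : 'I_n := widen_ord (leq_pred n) i.
Definition hi i : 'I_n := Ordinal (etrans (esym (ltn_predRL i n)) (ltn_ord i)).

Lemma adjE i : adjacent_transposition i = tperm (lo i) (hi i).
Proof. by []. Qed.

Lemma rank_adj x i a b : b != i.+1 ->
  rank (x * adjacent_transposition i) a b = rank x a b.
Proof.
move=> bi; rewrite /rank; congr #|pred_of_set _|; apply/setP => p; rewrite !inE permM adjE.
by congr (_ && _); case: tpermP => [->|->|//] /=; apply/idP/idP; move: bi => /eqP; lia.
Qed.

(** Products apply their left factor first, so multiplying x by s_i on the right exchanges the
    values i and i+1; this lengthens x exactly at an ascent. *)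
Definition ascent x i : bool := place x (lo i) < place x (hi i).

Lemma place_lo_hi x i : place x (lo i) != place x (hi i).
Proof. by apply/eqP => /place_inj /(congr1 val) /=; lia. Qed.

Lemma place_adj_lo x i : place (x * adjacent_transposition i) (lo i) = place x (hi i).
Proof. by rewrite /place invMg permM adjE tpermV tpermL. Qed.

Lemma place_adj_hi x i : place (x * adjacent_transposition i) (hi i) = place x (lo i).
Proof. by rewrite /place invMg permM adjE tpermV tpermR. Qed.

Lemma ascent_adj x i : ascent (x * adjacent_transposition i) i = ~~ ascent x i.
Proof.
have := place_lo_hi x i; rewrite /ascent place_adj_lo place_adj_hi -leqNgt => neq.
by rewrite [RHS]leq_eqVlt eq_sym (negbTE neq).
Qed.

Lemma adjK i : involutive (fun x => x * adjacent_transposition i).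
Proof. by move=> x /=; rewrite -mulgA adjE tperm2 mulg1. Qed.

(** Value i comes before value i+1, so the rank at i+1 is the largest one that the ranks at i and
    i+2 allow; at a descent it is the smallest. *)
Lemma rank_ascent x i a : ascent x i ->
  rank x a i.+1 = minn (rank x a i).+1 (rank x a i.+2).
Proof.
have := rankSr x a (lo i); have := rankSr x a (hi i); rewrite /= /ascent => -> ->.
by case: (ltnP (place x (hi i)) a) => h1; case: (ltnP (place x (lo i)) a) => h2 asc /=; lia.
Qed.

Lemma rank_descent x i a : ~~ ascent x i ->
  rank x a i.+1 = maxn (rank x a i) (rank x a i.+2).-1.
Proof.
have := rankSr x a (lo i); have := rankSr x a (hi i); rewrite /= /ascent => -> ->.
by case: (ltnP (place x (hi i)) a) => h1; case: (ltnP (place x (lo i)) a) => h2 asc /=; lia.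
Qed.

(** The smaller of x and x s_i in Bruhat order; [weak_up] is the larger. *)
Definition weak_down i x := if ascent x i then x else x * adjacent_transposition i.
Definition weak_up i x := if ascent x i then x * adjacent_transposition i else x.

Lemma rank_down i x a b : rank (weak_down i x) a b =
  if b == i.+1 then minn (rank x a i).+1 (rank x a i.+2) else rank x a b.
Proof.
rewrite /weak_down; case: ifP => asc; case: eqP => [->|/eqP bi] //.
- exact: rank_ascent.
- rewrite rank_ascent ?ascent_adj ?asc // !rank_adj //; apply/eqP; lia.
- exact: rank_adj.
Qed.

Lemma rank_up i x a b : rank (weak_up i x) a b =
  if b == i.+1 then maxn (rank x a i) (rank x a i.+2).-1 else rank x a b.
Proof.
rewrite /weak_up; case: ifP => asc; case: eqP => [->|/eqP bi] //.
- rewrite rank_descent ?ascent_adj ?asc // !rank_adj //; apply/eqP; lia.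
- exact: rank_adj.
- by apply: rank_descent; rewrite asc.
Qed.

(** The lifting property of the Bruhat order: the new rank at i+1 is a monotone function of the
    ranks at i and i+2, which s_i does not affect. *)
Lemma down_homo i x y : rank_order x y -> rank_order (weak_down i x) (weak_down i y).
Proof.
move=> xy a b; rewrite !rank_down; case: eqP => _; last exact: xy.
by have := xy a i; have := xy a i.+2; lia.
Qed.

Lemma up_homo i x y : rank_order x y -> rank_order (weak_up i x) (weak_up i y).
Proof.
move=> xy a b; rewrite !rank_up; case: eqP => _; last exact: xy.
by have := xy a i; have := xy a i.+2; lia.
Qed.

Lemma rank_bounds x a i : rank x a i <= rank x a i.+1 <= (rank x a i).+1 /\
  rank x a i.+1 <= rank x a i.+2 <= (rank x a i.+1).+1.
Proof.
have := rankSr x a (lo i); have := rankSr x a (hi i); rewrite /= => -> ->.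
by case: (_ < a); case: (_ < a); lia.
Qed.

Lemma down_le i x : rank_order (weak_down i x) x.
Proof.
move=> a b; rewrite rank_down; case: eqP => [->|//].
by have [] := rank_bounds x a i; lia.
Qed.

Lemma up_ge i x : rank_order x (weak_up i x).
Proof.
move=> a b; rewrite rank_up; case: eqP => [->|//].
by have [] := rank_bounds x a i; lia.
Qed.

(** The smaller of x and s_i x: the positions i and i+1 are exchanged instead of the values. *)
Definition down_right i x := (weak_down i x^-1)^-1.

Lemma rank_down_right i x a b : rank (down_right i x) a b =
  if a == i.+1 then minn (rank x i b).+1 (rank x i.+2 b) else rank x a b.
Proof. by rewrite /down_right rankV rank_down !rankV. Qed.

Lemma down_right_homo i x y :
  rank_order x y -> rank_order (down_right i x) (down_right i y).
Proof.
move=> xy; have xyV : rank_order x^-1 y^-1 by move=> a b; rewrite !rankV.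
by move=> a b; rewrite !rankV; apply: down_homo.
Qed.

(* An inversion whose image under the transposition is no longer increasing is
   still an inversion of the swapped permutation. *)
Lemma perm_length_tperm x (p q : 'I_n) : p < q -> x p < x q ->
  perm_length x < perm_length (tperm p q * x).
Proof.
move=> pq xpq; set t := tperm p q.
have tt : involutive t by move=> r; rewrite /t tpermK.
pose flip (r : 'I_n * 'I_n) := if t r.1 < t r.2 then (t r.1, t r.2) else r.
have flip_inj : {in [set r : 'I_n * 'I_n | (r.1 < r.2) && (x r.2 < x r.1)] &, injective flip}.
  move=> [r1 r2] [s1 s2]; rewrite !inE /flip /= => /andP[r12 _] /andP[s12 _].
  case: ifP => tr; case: ifP => ts //.
  - by move=> [/(can_inj tt) -> /(can_inj tt) ->].
  - by move=> [e1 e2]; move: ts; rewrite -e1 -e2 !tt r12.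
  - by move=> [e1 e2]; move: tr; rewrite e1 e2 !tt s12.
rewrite /perm_length -(card_in_imset flip_inj); apply: proper_card; apply/properP; split.
  apply/subsetP => r /imsetP[[r1 r2]]; rewrite inE /= => /andP[r12 xr] ->.
  rewrite /flip inE /=; case: ifP => tr /=; first by rewrite tr !permM !tt.
  rewrite r12 /= !permM; move: tr; rewrite /t.
  case: (tpermP p q r1) => [e1|e1|/eqP n1 /eqP n1']; case: (tpermP p q r2) => [e2|e2|/eqP n2 /eqP n2'] //;
   rewrite ?e1 ?e2 in r12 xr *; try by rewrite ?ltnn; lia.
exists (p, q); first by rewrite inE /= pq !permM tpermL tpermR.
apply/imsetP => -[[r1 r2]]; rewrite inE /= => /andP[r12 xr]; rewrite /flip /=.
case: ifP => tr [e1 e2].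
  have r1q : r1 = q by rewrite -(tt r1) -e1 /t tpermL.
  have r2p : r2 = p by rewrite -(tt r2) -e2 /t tpermR.
  by move: r12; rewrite r1q r2p; lia.
by move: xr; rewrite -e1 -e2; lia.
Qed.

(** An inversion of x s_i is one of x, except possibly the one formed by the positions of the values
    i and i+1. *)
Lemma perm_length_adj_le x i :
  perm_length (x * adjacent_transposition i) <= (perm_length x).+1.
Proof.
rewrite /perm_length; set A := [set _ | _]; set B := [set _ | _].
suff sub : A \subset (x^-1 (lo i), x^-1 (hi i)) |: B.
  by rewrite (leq_trans (subset_leq_card sub)) // cardsU1 -add1n leq_add2r leq_b1.
apply/subsetP => -[r1 r2]; rewrite !inE /= !permM adjE => /andP[r12].
have eq_inv (r v : 'I_n) : (r == x^-1 v) = (x r == v).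
  by apply/eqP/eqP => [->|<-]; rewrite ?permKV ?permK.
rewrite r12 /= xpair_eqE !eq_inv.
have neq : x r1 != x r2 by rewrite (inj_eq (@perm_inj _ x)) -val_eqE /=; lia.
move: (x r1) (x r2) neq => v1 v2; rewrite -!val_eqE /=.
case: tpermP => [->|->|/eqP n2 /eqP n2']; case: tpermP => [->|->|/eqP n1 /eqP n1'] /=;
  rewrite -?val_eqE /= ?eqxx //; try lia.
Qed.

Lemma ascent_length x i : ascent x i ->
  perm_length (x * adjacent_transposition i) = (perm_length x).+1.
Proof.
move=> asc; apply/eqP; rewrite eqn_leq perm_length_adj_le /=.
have -> : x * adjacent_transposition i = tperm (x^-1 (lo i)) (x^-1 (hi i)) * x.
  by rewrite -(tpermJ _ _ x^-1) conjgE invgK -!mulgA mulVg mulg1.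
by apply: perm_length_tperm; rewrite ?permKV.
Qed.

Lemma descent_length x i : ~~ ascent x i ->
  perm_length x = (perm_length (x * adjacent_transposition i)).+1.
Proof. by rewrite -ascent_adj => /ascent_length; rewrite adjK. Qed.

Lemma expression_perm_rcons (e : seq 'I_n.-1) i :
  expression_perm (rcons e i) = expression_perm e * adjacent_transposition i.
Proof. by rewrite /expression_perm -cats1 big_cat big_seq1. Qed.

Lemma perm_length1 : perm_length (1 : 'S_n) = 0.
Proof.
apply/eqP; rewrite cards_eq0 -subset0; apply/subsetP => -[p q].
by rewrite !inE /= !perm1; lia.
Qed.

Lemma perm_length_expression (e : seq 'I_n.-1) : perm_length (expression_perm e) <= size e.
Proof.
elim/last_ind: e => [|e i IH]; first by rewrite /expression_perm big_nil perm_length1.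
by rewrite expression_perm_rcons size_rcons (leq_trans (perm_length_adj_le _ _)).
Qed.

Lemma reduced_rcons x e i : reduced_expression x (rcons e i) ->
  [/\ reduced_expression (expression_perm e) e, ascent (expression_perm e) i
    & x = expression_perm e * adjacent_transposition i].
Proof.
rewrite /reduced_expression expression_perm_rcons size_rcons => -[<- len].
have := perm_length_expression e; have := perm_length_adj_le (expression_perm e) i.
have [/ascent_length|/descent_length] := boolP (ascent (expression_perm e) i); last by lia.
by split=> //; split=> //; lia.
Qed.

(** The positions of the values increase strictly and stay below n, hence [place x p] is at most p,
    and the inverse of x is below the identity in the rank order. *)
Lemma no_descent x : (forall i, ascent x i) -> x = 1.
Proof.
move=> asc; apply: invg_inj; rewrite invg1; apply: rank_order1 => a b.
have place_lt v : place x v < n by apply: ltn_ord.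
have le (p : 'I_n) : place x p <= p.
  have step j : forall (h : p + j < n), place x p + j <= place x (Ordinal h).
    elim: j => [|j IH] h; first by rewrite addn0 (_ : Ordinal h = p) //; apply: val_inj; rewrite /= addn0.
    have hj : p + j < n.-1 by lia.
    have hj' : p + j < n by lia.
    have := asc (Ordinal hj); rewrite /ascent.
    have -> : lo (Ordinal hj) = Ordinal hj' by apply: val_inj.
    have -> : hi (Ordinal hj) = Ordinal h by apply: val_inj; rewrite /= addnS.
    by have := IH hj'; lia.
  have h : p + (n.-1 - p) < n by have := ltn_ord p; lia.
  by have := step _ h; have := place_lt (Ordinal h); have := ltn_ord p; lia.
rewrite /rank; apply: subset_leq_card; apply/subsetP => p; rewrite !inE perm1.
by move=> /andP[pa pb]; rewrite pa /=; apply: leq_ltn_trans (le p) pb.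
Qed.

Lemma reduced_exists x : exists e, reduced_expression x e.
Proof.
elim/ltn_ind: {x}(perm_length x) {-2}x (erefl (perm_length x)) => m IH x def_m.
have [/forallP /no_descent ->|] := boolP [forall i, ascent x i].
  by exists [::]; split; rewrite /expression_perm ?big_nil ?perm_length1.
rewrite negb_forall => /existsP[i /descent_length len].
have [|e [def_e sz_e]] := IH (perm_length (x * adjacent_transposition i)) _ _ erefl.
  by rewrite -def_m len.
exists (rcons e i); split; first by rewrite expression_perm_rcons def_e adjK.
by rewrite size_rcons sz_e len.
Qed.

End Rank.

(** * From the rank criterion to Bruhat covers *)

Section Criterion.

Variable n : nat.
Implicit Types (u v x : 'S_n) (a b : nat) (p q r : 'I_n).

Local Open Scope group_scope.

Lemma rank_over x a b : n <= a -> rank x a b = minn b n.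
Proof.
move=> na; have [bn|nb] := leqP b n.
  rewrite -[RHS](rank_n x bn); congr #|pred_of_set _|; apply/setP => p; rewrite !inE.
  by rewrite (leq_trans (ltn_ord p) na) ltn_ord.
rewrite -[RHS](@card_ord n) -cardsT; congr #|pred_of_set _|; apply/setP => p; rewrite !inE.
by rewrite (leq_trans (ltn_ord p) na) (ltn_trans (ltn_ord _) nb).
Qed.

Lemma rank_le_row x a b b' : b <= b' -> rank x a b <= rank x a b'.
Proof.
move=> bb'; apply: subset_leq_card; apply/subsetP => p; rewrite !inE => /andP[-> h].
exact: leq_trans bb'.
Qed.

Lemma rank_tperm x p q a b : p < q -> x p < x q ->
  rank (tperm p q * x) a b + ((p < a <= q) && (x p < b <= x q)) = rank x a b.
Proof.
move=> pq xpq; elim: a => [|a IH]; first by rewrite !rank0l ltn0.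
have [an|na] := ltnP a n; last first.
  by move: IH; have := ltn_ord q; rewrite !rank_over ?(leqW na) //; lia.
move: IH; have := rankS (tperm p q * x) (Ordinal an) b; have := rankS x (Ordinal an) b.
rewrite /= permM => -> -> <-.
case: tpermP => [ep|eq|/eqP np /eqP nq].
- have ea : a = p by rewrite -ep.
  by rewrite ep; lia.
- have ea : a = q by rewrite -eq.
  by rewrite eq; lia.
have {}np : a != p by apply: contraNneq np => ?; apply/eqP/val_inj.
have {}nq : a != q by apply: contraNneq nq => ?; apply/eqP/val_inj.
by rewrite (_ : (p < a.+1 <= q) = (p < a <= q)); [lia | apply/idP/idP; lia].
Qed.

(** Take for p the first position where u and v differ, which forces u p < v p, and for q the first
    later position with u p < u q <= v p. The exchange lowers the rank of u by one on a rectangle,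
    where v already has strictly smaller rank. *)
Lemma rank_order_step u v : rank_order u v -> u != v ->
  exists p q, [/\ p < q, u p < u q & rank_order (tperm p q * u) v].
Proof.
move=> uv neq.
have exp : exists a, [exists p : 'I_n, (p == a :> nat) && (u p != v p)].
  suff : [exists p, u p != v p].
    by case/existsP => p neqp; exists p; apply/existsP; exists p; rewrite eqxx.
  rewrite -[X in is_true X]negbK negb_exists; apply: contra neq => /forallP eqp.
  by apply/eqP/permP => p; apply/eqP; rewrite -[_ == _]negbK.
have [a /existsP[p /andP[/eqP <-{a} neqp]] minp] := ex_minnP exp.
have eq_before r : r < p -> u r = v r.
  move=> rp; apply/eqP; apply: contraLR rp => neqr; rewrite -leqNgt; apply: minp.
  by apply/existsP; exists r; rewrite eqxx.
have rank_p b : rank u p b = rank v p b.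
  congr #|pred_of_set _|; apply/setP => r; rewrite !inE.
  by case: (ltnP r p) => //= /eq_before ->.
have lt_p : u p < v p.
  have := uv p.+1 (v p).+1; rewrite !rankS rank_p ltnSn => h.
  by have : (u p : nat) != v p by []; lia.
have exq : exists a, [exists q : 'I_n, (q == a :> nat) && (p < q) && (u p < u q <= v p)].
  exists (u^-1 (v p)); apply/existsP; exists (u^-1 (v p)); rewrite eqxx permKV lt_p leqnn andbT /=.
  case: ltngtP => // [lt|e].
    have := eq_before _ lt; rewrite permKV => /perm_inj e.
    by move: lt; rewrite -e ltnn.
  have {}e : p = u^-1 (v p) by apply: val_inj.
  by move: neqp; rewrite {1}e permKV eqxx.
have [a /existsP[q /andP[/andP[/eqP <-{a} pq] /andP[upq uqv]]] minq] := ex_minnP exq.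
exists p, q; split=> // a b; have := rank_tperm a b pq upq.
case: andP => [[/andP[pa aq] /andP[ub bu]]|_] /=; last by rewrite addn0 => ->.
(* By the choice of q, u takes no value from b to v p between p and a. Hence the strict inequality
   at height b follows from the hypothesis at height v p + 1 and from v p not being below b. *)
have gap r : p < r -> r < a -> (u r < b) = (u r < (v p).+1).
  move=> pr ra; apply/idP/idP => h; first by lia.
  have {}ra : r < q by lia.
  apply: contraLR ra => hb; rewrite -leqNgt; apply: minq; apply/existsP; exists r.
  by rewrite eqxx pr /=; lia.
pose c := (v p).+1; have bc : b <= c by rewrite /c; lia.
have step k : p.+1 + k <= a ->
    rank u (p.+1 + k) b + rank u p.+1 c = rank u (p.+1 + k) c + rank u p.+1 b /\
    rank v (p.+1 + k) b + rank v p.+1 c <= rank v (p.+1 + k) c + rank v p.+1 b.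
  elim: k => [|k IH] ka; first by rewrite addn0; lia.
  have [|IH1 IH2] := IH _; first lia.
  have kn : p.+1 + k < n by have := ltn_ord q; lia.
  have := rankS u (Ordinal kn); have := rankS v (Ordinal kn); rewrite /= addnS => ev eu.
  rewrite !eu !ev gap /=; [|lia|lia].
  split; first by rewrite -/c; lia.
  by case: (ltnP (v (Ordinal kn)) b) => h; [rewrite (leq_trans h bc)|]; lia.
have [|] := step (a - p.+1); first lia.
rewrite subnKC // !rankS !rank_p /c ltnSn => e1 e2.
have := uv a (v p).+1.
have vb : (v p < b) = false by lia.
by move: e1 e2; rewrite vb ub (ltn_trans lt_p) //; lia.
Qed.

(** Each exchange lengthens u, and lengths are bounded by the number of pairs of positions. *)
Lemma rank_order_bruhat u v : rank_order u v -> bruhat u v.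
Proof.
elim/ltn_ind: {u}(#|{: 'I_n * 'I_n}| - perm_length u) {-2}u (erefl (#|{: 'I_n * 'I_n}| - perm_length u)).
move=> m IH u def_m uv; have [->|neq] := eqVneq u v; first exact: connect0.
have [p [q [pq upq uv']]] := rank_order_step uv neq.
have len := perm_length_tperm pq upq.
have maxlen : perm_length (tperm p q * u) <= #|{: 'I_n * 'I_n}| by apply: max_card.
apply: connect_trans (connect1 _) (IH _ _ _ erefl uv'); last by lia.
rewrite /= len; apply/existsP; exists (u p); apply/existsP; exists (u q).
by rewrite -tpermJ -conjgC.
Qed.

(* Between two members of S the values of u increase, so there the rank
   function of u is the largest one compatible with its values on S. *)
Lemma rank_order_blocks (S : pred nat) u v :
  (forall i : 'I_n.-1, ~~ S i.+1 -> u (lo i) < u (hi i)) ->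
  (forall a b, S a -> rank v a b <= rank u a b) -> rank_order u v.
Proof.
move=> incr leS a b.
have inc (k : nat) (h : k.+1 < n) : ~~ S k.+1 -> u (Ordinal (ltnW h)) < u (Ordinal h).
  move=> nS; have hk : k < n.-1 by lia.
  have := incr (Ordinal hk) nS.
  have -> : lo (Ordinal hk) = Ordinal (ltnW h) by apply: val_inj.
  by have -> : hi (Ordinal hk) = Ordinal h by apply: val_inj.
(* Back to the start of the block u stays below b, so its rank grows by one at each position, at
   least as fast as that of v. *)
have left k : forall h : k < n, u (Ordinal h) < b -> rank v k.+1 b <= rank u k.+1 b.
  elim: k => [|k IH] h ub.
    have := rankS u (Ordinal h) b; have := rankS v (Ordinal h) b; rewrite /= !rank0l ub => -> ->.
    by case: (_ < b).
  have := rankS u (Ordinal h) b; have := rankS v (Ordinal h) b; rewrite /= ub => -> ->.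
  apply: leq_add; last by case: (_ < b).
  have [/leS //|nS] := boolP (S k.+1); have ltu := inc _ h nS.
  by apply: (IH (ltnW h)); apply: ltn_trans ltu ub.
(* Up to the end of the block u stays at or above b, so its rank is constant, while that of v can
   only grow. *)
have right j : forall k (h : k < n), n - k <= j -> b <= u (Ordinal h) -> rank v k b <= rank u k b.
  elim: j => [|j IH] k h kj bu; first by lia.
  have := rankS u (Ordinal h) b; have := rankS v (Ordinal h) b; rewrite /= => ev eu.
  suff : rank v k.+1 b <= rank u k.+1 b by lia.
  have [h1|nk] := ltnP k.+1 n; last by rewrite !rank_over.
  have [/leS //|nS] := boolP (S k.+1); have ltu := inc _ h1 nS.
  apply: (IH _ h1); first by lia.
  apply: leq_trans (ltnW ltu); rewrite (_ : Ordinal (ltnW h1) = Ordinal h) //.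
  exact: val_inj.
case: a => [|a]; first by rewrite !rank0l.
have [h|na] := ltnP a.+1 n; last by rewrite !rank_over.
have [/leS //|nS] := boolP (S a.+1); have ltu := inc _ h nS.
have [/left //|bu] := ltnP (u (Ordinal (ltnW h))) b.
by apply: (right _ _ h (leqnn _)); apply: leq_trans (ltnW ltu).
Qed.

End Criterion.

(** * Demazure crystals *)

Section Chain.

Variables (n : nat) (lam : n.-tuple nat).
Hypothesis lamP : is_partition lam.

Notation L p := (nth 0 lam p).
Notation len := (col_len lam).
Notation below := (below lam).
Notation col_occ := (col_occ lam).
Notation col_from := (col_from lam).
Notation ssyt := (ssyt lam).

Implicit Types (T : tableau) (i : 'I_n.-1) (w : 'S_n) (X : nat -> 'S_n).

Lemma col_occ_le1 x T c : ssyt T -> col_occ x T c <= 1.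
Proof.
move=> sT; rewrite leqNgt; apply/negP => two; have eb := belowS lam T c x.
pose p := below T c x; have hp : p.+1 < below T c x.+1 by rewrite eb -/p; lia.
have cp : c < L p.+1 by rewrite -(lt_col_len lamP) (leq_trans hp) // below_len.
have := entry_lt_below lamP x.+1 sT cp; rewrite hp.
have := entry_strict lamP sT (ltnSn p) cp.
have cp' := leq_trans cp (part_le lamP (leqnSn p)).
have := entry_lt_below lamP x sT cp'; rewrite ltnn.
by lia.
Qed.

Lemma raise_spec (i : nat) T T' : ssyt T -> tableau_raise i T = Some T' ->
  ssyt T' /\ exists k, [/\ k < L 0,
    forall c b, below T' c b = below T c b + ((c == k) && (b == i.+1)),
    col_occ i T k = 0 /\ col_occ i.+1 T k = 1,
    forall c, col_from i.+1 T c + col_from i T k <= col_from i.+1 T k + col_from i T c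
  & forall c, k < c ->
      col_from i.+1 T c + col_from i T k < col_from i.+1 T k + col_from i T c].
Proof.
move=> sT /(ssyt_raise_Some lamP sT)[sT' [k [bT' le_k lt_k]]]; split=> //; exists k.
have occ_k : col_occ i T k = 0 /\ col_occ i.+1 T k = 1.
  have := lt_k _ (ltnSn k); rewrite !(col_fromS lamP _ _ k).
  by have := col_occ_le1 i.+1 k sT; lia.
split=> //; rewrite ltnNge; apply/negP => Lk; case: occ_k => _.
rewrite /col_occ big1 // => p _.
by rewrite ltnNge (leq_trans (part_le lamP (leq0n p)) Lk).
Qed.

(** On semistandard tableaux this is the sum of the entries, the measure for inductions along
    raising operators. *)
Definition defect T : nat :=
  \sum_(0 <= c < L 0) \sum_(0 <= b < n) (len c - below T c b.+1).

Lemma raise_defect i T T' : ssyt T -> tableau_raise i T = Some T' -> defect T' < defect T.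
Proof.
move=> sT /(raise_spec sT)[sT' [k [kL bT' _ _ _]]]; rewrite /defect.
have in_n : i < n by have := ltn_ord i; lia.
have le c b : len c - below T' c b <= len c - below T c b by rewrite bT'; lia.
have lt : len k - below T' k i.+1 < len k - below T k i.+1.
  by have := below_len lam T' k i.+1; rewrite bT' !eqxx; lia.
rewrite (bigD1_seq k) ?mem_index_iota ?iota_uniq //= [X in _ < X](bigD1_seq k) ?mem_index_iota ?iota_uniq //=.
rewrite -addSn; apply: leq_add; last first.
  by apply: leq_sum => c _; apply: leq_sum => b _; apply: le.
rewrite (bigD1_seq (val i)) ?mem_index_iota ?iota_uniq //= [X in _ < X](bigD1_seq (val i)) ?mem_index_iota ?iota_uniq //=.
by rewrite -addSn; apply: leq_add => //; apply: leq_sum => b _; apply: le.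
Qed.

Lemma col_occ_raise (i : nat) T T' k :
  (forall c b, below T' c b = below T c b + ((c == k) && (b == i.+1))) ->
  forall c, col_occ i T' c = col_occ i T c + (c == k) /\
            col_occ i.+1 T' c + (c == k) = col_occ i.+1 T c.
Proof.
move=> bT' c; have := bT' c i; have := bT' c i.+1; have := bT' c i.+2.
rewrite !(belowS lam _ c i.+1) !(belowS lam _ c i) eqxx.
have -> : (i == i.+1) = false by apply/eqP; lia.
have -> : (i.+2 == i.+1) = false by apply/eqP; lia.
by case: (c == k); lia.
Qed.

Lemma col_from_raise (i : nat) T T' k : k < L 0 ->
  (forall c b, below T' c b = below T c b + ((c == k) && (b == i.+1))) ->
  forall c, col_from i T' c = col_from i T c + (c <= k) /\
            col_from i.+1 T' c + (c <= k) = col_from i.+1 T c.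
Proof.
move=> kL bT' c; have occT' := col_occ_raise bT'.
have sum_k : \sum_(c <= c' < L 0) (c' == k) = (c <= k).
  case: (leqP c k) => ck.
    rewrite (bigD1_seq k) ?mem_index_iota ?iota_uniq ?ck //= eqxx big1 // => j /negbTE -> //.
  by rewrite big_nat big1 // => j /andP[cj _]; case: eqP => // ejk; lia.
rewrite /col_from -sum_k -!big_split; split; apply: eq_bigr => j _;
  by have [] := occT' j.
Qed.

(** The image determines the changed column k: k+1 is the leftmost index at which the excess in the
    column reading of the image is maximal. *)
Lemma tableau_raise_inj (i : nat) T1 T2 T : ssyt T1 -> ssyt T2 ->
  tableau_raise i T1 = Some T -> tableau_raise i T2 = Some T -> T1 = T2.
Proof.
have lt_absurd S1 S2 k1 k2 : k1 < k2 -> ssyt S1 -> ssyt S2 -> k1 < L 0 -> k2 < L 0 ->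
    (forall c b, below T c b = below S1 c b + ((c == k1) && (b == i.+1))) ->
    (forall c b, below T c b = below S2 c b + ((c == k2) && (b == i.+1))) ->
    (col_occ i S1 k1 = 0 /\ col_occ i.+1 S1 k1 = 1) ->
    (col_occ i S2 k2 = 0 /\ col_occ i.+1 S2 k2 = 1) ->
    (forall c, k1 < c -> col_from i.+1 S1 c + col_from i S1 k1 <
       col_from i.+1 S1 k1 + col_from i S1 c) ->
    (forall c, col_from i.+1 S2 c + col_from i S2 k2 <=
       col_from i.+1 S2 k2 + col_from i S2 c) -> False.
  move=> k12 sS1 sS2 k1L k2L b1 b2 occ1 occ2 h1 h2.
  have := h1 k2.+1 (leqW k12); have := h2 k1.+1.
  have := col_from_raise k1L b1 k1.+1; have := col_from_raise k1L b1 k2.+1.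
  have := col_from_raise k2L b2 k1.+1; have := col_from_raise k2L b2 k2.+1.
  rewrite (col_fromS lamP i S1 k1) (col_fromS lamP i.+1 S1 k1).
  rewrite (col_fromS lamP i S2 k2) (col_fromS lamP i.+1 S2 k2).
  by lia.
move=> sT1 sT2 /(raise_spec sT1)[_ [k1 [k1L b1 occ1 le1 lt1]]].
move=> /(raise_spec sT2)[_ [k2 [k2L b2 occ2 le2 lt2]]].
have [k12|k21|ek] := ltngtP k1 k2.
- by case: (lt_absurd T1 T2 k1 k2).
- by case: (lt_absurd T2 T1 k2 k1).
apply: (below_inj lamP) => // c b; apply/eqP.
by rewrite -(eqn_add2r ((c == k1) && (b == i.+1))) -b1 ek -b2.
Qed.

(* The columns of T, from left to right, are initial segments of an increasing
   sequence of permutations bounded by w: the standardness condition of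
   Lakshmibai and Seshadri. *)
Definition chain w T : Prop := exists X,
  [/\ forall c, rank_order (X c) (X c.+1), forall c, rank_order (X c) w
    & forall c b, below T c b = rank (X c) (len c) b].

Lemma chain_mono w w' T : rank_order w w' -> chain w T -> chain w' T.
Proof.
move=> ww' [X [incX leX colX]]; exists X; split=> // c.
exact: rank_order_trans (leX c) ww'.
Qed.

Lemma col_rank i T c (x : 'S_n) : (forall b, below T c b = rank x (len c) b) ->
  [/\ rank x (len c) i.+1 = rank x (len c) i + col_occ i T c &
      rank x (len c) i.+2 = rank x (len c) i.+1 + col_occ i.+1 T c].
Proof. by move=> colx; rewrite -!colx !belowS. Qed.

(** The column is the set of the first [len c] values of x; if it has i but not i+1, then i precedes
    i+1 in x. *)
Lemma col_ascent i T c (x : 'S_n) : (forall b, below T c b = rank x (len c) b) ->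
  col_occ i.+1 T c < col_occ i T c -> ascent x i.
Proof.
move=> /(col_rank i)[e1 e2]; apply: contraLR => /(rank_descent (len c)).
by have := rank_bounds x (len c) i; lia.
Qed.

Lemma col_descent i T c (x : 'S_n) : (forall b, below T c b = rank x (len c) b) ->
  col_occ i T c < col_occ i.+1 T c -> ~~ ascent x i.
Proof.
move=> /(col_rank i)[e1 e2] lt; apply/negP => /(rank_ascent (len c)).
by have := rank_bounds x (len c) i; lia.
Qed.

(** Order could fail only from a kept member to a lowered one; an ascent there means that lowering
    does nothing. *)
Lemma down_inc i X (inside : pred nat) :
  (forall c, rank_order (X c) (X c.+1)) ->
  (forall c, inside c -> ~~ inside c.+1 -> ascent (X c.+1) i) ->
  forall c, rank_order (if inside c then X c else weak_down i (X c))
              (if inside c.+1 then X c.+1 else weak_down i (X c.+1)).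
Proof.
move=> incX asc c; case: ifP => in_c; case: ifP => in_c1; first exact: incX.
- by rewrite /weak_down asc ?in_c1.
- exact: rank_order_trans (@down_le _ _ _) (incX c).
exact: down_homo.
Qed.

Lemma up_inc i X (inside : pred nat) :
  (forall c, rank_order (X c) (X c.+1)) ->
  (forall c, ~~ inside c -> inside c.+1 -> ~~ ascent (X c) i) ->
  forall c, rank_order (if inside c then X c else weak_up i (X c))
              (if inside c.+1 then X c.+1 else weak_up i (X c.+1)).
Proof.
move=> incX desc c; case: ifP => in_c; case: ifP => in_c1; first exact: incX.
- exact: rank_order_trans (incX c) (@up_ge _ _ _).
- by rewrite /weak_up (negbTE (desc _ _ _)) ?in_c.
exact: up_homo.
Qed.

(* In the column reading, up to the changed column k, bracketed columns keep
   their permutation and the others are moved down; columns before k are kept. *)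
Lemma chain_raise i w T T' : ssyt T -> tableau_raise i T = Some T' ->
  chain w T -> chain w T'.
Proof.
move=> sT /(raise_spec sT)[_ [k [kL bT' occ_k le_k lt_k]]] [X [incX leX colX]].
pose inside c := (k < c) || (c < k) &&
  (col_from i.+1 T c.+1 + col_from i T k < col_from i.+1 T k + col_from i T c.+1).
exists (fun c => if inside c then X c else weak_down i (X c)); split.
- apply: down_inc => // c; rewrite /inside => in_c in_c1.
  have ck : c.+1 < k.
    by case: (ltngtP c.+1 k) => // h; move: in_c in_c1; rewrite ?h; lia.
  apply: (col_ascent (colX _)); have := le_k c.+2; move: in_c in_c1.
  by rewrite (col_fromS lamP i T c.+1) (col_fromS lamP i.+1 T c.+1); lia.
- move=> c; apply: rank_order_trans (leX c); case: ifP => _ //.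
  exact: down_le.
move=> c b; rewrite bT' colX; have [e1 e2] := col_rank i (colX c).
case: ifP => in_c.
  have -> : (c == k) = false by apply/eqP => eck; move: in_c; rewrite /inside eck ltnn.
  by rewrite addn0.
rewrite rank_down; case: (b =P i.+1) => [->|_]; last by rewrite andbF addn0.
rewrite andbT; have := col_occ_le1 i.+1 c sT; have := col_occ_le1 i c sT.
have [eck|/eqP neck] := c =P k; first by rewrite eck in e1 e2 *; lia.
move: in_c; rewrite /inside; have := le_k c.
rewrite (col_fromS lamP i T c) (col_fromS lamP i.+1 T c).
by case: (ltngtP c k) neck => //= ck _; lia.
Qed.

(** Moved up are column k and the columns right of it whose excess equals that at k+1. The latter
    never have i without i+1, so their entries stay; where such a run ends, the column has i+1
    without i, hence a descent. The bound survives because w is the larger of w and w s_i. *)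
Lemma chain_lower i w T T' : ssyt T -> tableau_raise i T = Some T' ->
  ~~ ascent w i -> chain w T' -> chain w T.
Proof.
move=> sT /(raise_spec sT)[_ [k [kL bT' occ_k le_k lt_k]]] desc [X [incX leX colX]].
have occT' := col_occ_raise bT'.
pose inside c := (c < k) || (k < c) &&
  (col_from i.+1 T c + col_from i T k.+1 < col_from i.+1 T k.+1 + col_from i T c).
have from_k x := col_fromS lamP x T k; have from_S x c := col_fromS lamP x T c.
exists (fun c => if inside c then X c else weak_up i (X c)); split.
- apply: up_inc => // c; rewrite /inside => in_c in_c1.
  have := occT' c; have := from_S i c; have := from_S i.+1 c => f1 f2 o12.
  have ck : k < c by case: (ltngtP c k) => // h; move: in_c in_c1; rewrite ?h; lia.
  apply: (col_descent (colX _)); move: in_c in_c1; rewrite (gtn_eqF ck) in o12.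
  by lia.
- move=> c; case: ifP => _ //.
  by have := up_homo i (leX c); rewrite {2}/weak_up (negbTE desc).
move=> c b; have := bT' c b; rewrite colX; have [e1 e2] := col_rank i (colX c).
have [o1 o2] := occT' c; case: ifP => in_c.
  have -> : (c == k) = false by apply/eqP => eck; move: in_c; rewrite /inside eck ltnn.
  by rewrite addn0 => ->.
rewrite rank_up; case: (b =P i.+1) => [->|_]; last by rewrite andbF addn0 => ->.
rewrite andbT; have := col_occ_le1 i.+1 c sT; have := col_occ_le1 i c sT.
have [eck|/eqP neck] := c =P k; first by rewrite eck eqxx in e1 e2 o1 o2 *; lia.
rewrite (negbTE neck) in o1 o2 *; have f1 := from_k i; have f2 := from_k i.+1; have g1 := from_S i c; have g2 := from_S i.+1 c.
move: in_c; rewrite /inside; case: (ltngtP c k) neck => //= ck _.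
by have := lt_k _ ck; have := lt_k _ (leqW ck); lia.
Qed.

(** The excess is nowhere positive, and the columns c with excess zero at c+1 are lowered; they
    never have i+1 without i, so their entries stay. Past the last column every member is lowered,
    which bounds the whole increasing sequence by [weak_down i w]. *)
Lemma chain_down i w T : ssyt T -> tableau_raise i T = None ->
  chain w T -> chain (weak_down i w) T.
Proof.
move=> sT none [X [incX leX colX]]; have le0 c := ssyt_raise_None lamP c sT none.
pose inside c := col_from i.+1 T c.+1 < col_from i T c.+1.
have incY := @down_inc i X inside incX.
have {}incY : forall c, rank_order (if inside c then X c else weak_down i (X c))
              (if inside c.+1 then X c.+1 else weak_down i (X c.+1)).
  apply: incY => c; rewrite /inside => in_c in_c1; apply: (col_ascent (colX _)).
  by move: in_c in_c1; rewrite (col_fromS lamP i T c.+1) (col_fromS lamP i.+1 T c.+1); lia.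
exists (fun c => if inside c then X c else weak_down i (X c)); split=> //.
- move=> c; have big_c j : L 0 <= j ->
      rank_order (if inside j then X j else weak_down i (X j)) (weak_down i w).
    move=> Lj; rewrite /inside /col_from !big_geq ?leqW //; exact: down_homo.
  have le_add j : rank_order (if inside c then X c else weak_down i (X c))
      (if inside (c + j) then X (c + j) else weak_down i (X (c + j))).
    elim: j => [|j IH]; first by rewrite addn0.
    by rewrite addnS; apply: rank_order_trans IH (incY _).
  by apply: rank_order_trans (le_add (L 0)) (big_c _ _); rewrite leq_addl.
move=> c b; rewrite colX; have [e1 e2] := col_rank i (colX c); case: ifP => in_c //.
rewrite rank_down; case: (b =P i.+1) => // ->.
have := col_occ_le1 i.+1 c sT; have := col_occ_le1 i c sT.
move: in_c; rewrite /inside; have := le0 c.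
by rewrite (col_fromS lamP i T c) (col_fromS lamP i.+1 T c); lia.
Qed.

Lemma len_le c : len c <= n.
Proof.
rewrite -[X in _ <= X]subn0 -[X in _ <= X]muln1 -sum_nat_const_nat.
by apply: leq_sum => p _; apply: leq_b1.
Qed.

(** No column has length i+1, the only length at which [down_right i] alters ranks. *)
Lemma chain_down_right i w T : L i = L i.+1 -> chain w T -> chain (down_right i w) T.
Proof.
move=> eL [X [incX leX colX]]; exists (fun c => down_right i (X c)); split.
- by move=> c; apply: down_right_homo.
- by move=> c; apply: down_right_homo.
move=> c b; rewrite colX rank_down_right; case: eqP => // e.
have := lt_col_len lamP i c; have := lt_col_len lamP i.+1 c.
by rewrite e ltnS leqnn ltnn eL => <-.
Qed.

Lemma entry_highest p c : c < L p -> entry (highest lam) p c = p.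
Proof.
move=> cp; rewrite /entry /highest nth_mkseq ?(part_lt cp) //.
by rewrite nth_nseq cp.
Qed.

Lemma ssyt_highest : ssyt (highest lam).
Proof.
apply/(ssytP lamP); split.
- apply: (@eq_from_nth _ 0); first by rewrite size_map size_mkseq size_tuple.
  move=> p; rewrite size_map size_mkseq => pn.
  by rewrite (nth_map [::]) ?size_mkseq // nth_mkseq // size_nseq.
- by move=> p c cp; rewrite entry_highest // (part_lt cp).
- by move=> p c c' cc' cp; rewrite !entry_highest //; apply: leq_ltn_trans cp.
move=> p c cp; rewrite !entry_highest //.
exact: leq_trans cp (part_le lamP (leqnSn p)).
Qed.

Lemma below_highest c b : below (highest lam) c b = minn (len c) b.
Proof.
rewrite -sum_ltn /below.
rewrite [RHS](_ : _ = \sum_(0 <= p < n) ((c < L p) && (p < b))); last first.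
  rewrite [RHS](big_cat_nat (n := len c)) ?len_le //= [X in _ = _ + X]big_nat.
  rewrite [X in _ = _ + X]big1 ?addn0.
    by apply: eq_big_nat => p /andP[_]; rewrite (lt_col_len lamP) => ->.
  by move=> p /andP[pl _]; rewrite -(lt_col_len lamP) ltnNge pl.
by apply: eq_bigr => p _; case: (ltnP c (L p)) => //= cp; rewrite entry_highest.
Qed.

Lemma chain_highest w : chain w (highest lam).
Proof.
have ge1 x : rank_order 1%g (x : 'S_n).
  move=> a b; have [an|na] := leqP a n; last by rewrite !rank_over // ltnW.
  by rewrite rank_1 // leq_min rank_le andbT -rankV rank_le.
exists (fun => 1%g); split=> [c|c|c b]; [exact: ge1 | exact: ge1 |].
by rewrite below_highest rank_1 ?len_le.
Qed.

Lemma chain1 T : ssyt T -> chain 1%g T -> T = highest lam.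
Proof.
move=> sT [X [_ leX colX]]; apply: (below_inj lamP) => // [|c b].
  exact: ssyt_highest.
by rewrite below_highest colX (rank_order1 (leX c)) rank_1 ?len_le.
Qed.

(** By [chain_down], the bound w can be shortened at each descent until it is the identity. *)
Lemma highest_unique w T : ssyt T -> (forall i, tableau_raise i T = None) ->
  chain w T -> T = highest lam.
Proof.
move=> sT none; elim/ltn_ind: {w}(perm_length w) {-2}w (erefl (perm_length w)) => m IH w def_m cT.
have [/forallP /no_descent w1|] := boolP [forall i, ascent w i].
  by apply: chain1 => //; rewrite -w1.
rewrite negb_forall => /existsP[i desc]; apply: (IH _ _ _ erefl (chain_down sT (none i) cT)).
by rewrite -def_m (descent_length desc) /weak_down (negbTE desc).
Qed.

(** A raised tableau would still satisfy the chain condition for the identity, hence be the same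
    tableau, although raising decreases [defect]. *)
Lemma raise_highest i : tableau_raise i (highest lam) = None.
Proof.
case E: tableau_raise => [T|] //.
have [sT _] := raise_spec ssyt_highest E.
have eT := chain1 sT (chain_raise ssyt_highest E (chain_highest _)).
by have := raise_defect ssyt_highest E; rewrite eT ltnn.
Qed.

Lemma iter_raise_ssyt i k T T' : ssyt T ->
  iter k (obind (tableau_raise i)) (Some T) = Some T' -> ssyt T'.
Proof.
move=> sT; elim: k T' => [T' [<-] //|k IH T'] /=.
by case E: (iter k _ _) => [T1|] //= /(raise_spec (IH _ E))[].
Qed.

Lemma chain_iter_lower i w k T T' : ~~ ascent w i -> ssyt T ->
  iter k (obind (tableau_raise i)) (Some T) = Some T' -> chain w T' -> chain w T.
Proof.
move=> desc sT; elim: k T' => [T' [<-] //|k IH T'] /=.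
case E: (iter k _ _) => [T1|] //= r1 cT'; apply: (IH _ E).
exact: chain_lower (iter_raise_ssyt sT E) r1 desc cT'.
Qed.

Lemma chain_iter_raise i w T : ssyt T -> chain w T -> exists k T',
  [/\ iter k (obind (tableau_raise i)) (Some T) = Some T', ssyt T', chain w T'
    & tableau_raise i T' = None].
Proof.
elim/ltn_ind: {T}(defect T) {-2}T (erefl (defect T)) => m IH T def_m sT cT.
case E: (tableau_raise i T) => [T1|]; last by exists 0, T.
have [sT1 _] := raise_spec sT E.
have := IH _ _ _ erefl sT1 (chain_raise sT E cT).
rewrite -def_m => /(_ (raise_defect sT E))[k [T' [itk sT' cT' noT']]].
by exists k.+1, T'; rewrite iterSr /= E.
Qed.

(** For a last letter i, [chain_lower] shows that the condition for w is stable under undoing e_i;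
    conversely the top of the i-string of T satisfies the condition for w s_i by [chain_down]. *)
Lemma demazure_expressionP w e T : reduced_expression w e ->
  demazure_expression lam e T <-> ssyt T /\ chain w T.
Proof.
elim/last_ind: e w T => [|e i IH] w T.
  move=> [<- _]; rewrite /expression_perm big_nil /demazure_expression /=.
  by split=> [->|[sT /(chain1 sT)]]; last by []; split; [apply: ssyt_highest | apply: chain_highest].
move=> /reduced_rcons[red asc def_w].
rewrite /demazure_expression -cats1 foldl_cat /=; split.
  move=> [sT [k [T' itk dT']]]; split=> //.
  have [sT' cT'] := (IH _ T' red).1 dT'.
  apply: (chain_iter_lower _ sT itk); first by rewrite def_w ascent_adj asc.
  apply: chain_mono cT'; rewrite def_w.
  by have := @up_ge _ i (expression_perm e); rewrite /weak_up asc.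
move=> [sT cT]; split=> //; have [k [T' [itk sT' cT' noT']]] := chain_iter_raise i sT cT.
exists k; exists T' => //; apply/(IH _ T' red); split=> //.
have := chain_down sT' noT' cT'; rewrite def_w /weak_down ascent_adj asc /=.
by rewrite adjK.
Qed.

Lemma demazureP w T : demazure lam w T <-> ssyt T /\ chain w T.
Proof.
split=> [[e red /(demazure_expressionP _ red)] //|cT].
by have [e red] := reduced_exists w; exists e => //; apply/(demazure_expressionP _ red).
Qed.

End Chain.

(** * Key tableaux and permutations of minimal length *)

Section Minimal.

Variables (n : nat) (lam : n.-tuple nat).
Hypothesis lamP : is_partition lam.

Notation L p := (nth 0 lam p).
Notation len := (col_len lam).

Implicit Types (T : tableau) (i : 'I_n.-1) (u v w : 'S_n).

(** For p < k <= n, the p-th smallest, counted from 0, of the first k values of u: it counts the v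
    smaller than that value. *)
Definition key_entry u (k p : nat) : nat := \sum_(0 <= v < n) (rank u k v.+1 <= p).

Lemma key_entry_lt u k p b : b <= n -> (key_entry u k p < b) = (p < rank u k b).
Proof.
move=> bn; apply/idP/idP => [|pb].
  apply: contraTT; rewrite -!leqNgt => bp.
  have eb : b = \sum_(0 <= v < n) (v < b) by rewrite sum_ltn; lia.
  rewrite eb; apply: leq_sum => v _; case: (ltnP v b) => // vb.
  by rewrite (leq_trans (rank_le_row u k vb)).
case: b pb bn => [|b] pb bn; first by have := rank_le u k 0; lia.
have eb : minn n b <= b by lia.
apply: leq_trans eb; rewrite -sum_ltn; apply: leq_sum => v _.
case: (ltnP v b) => [_|bv]; first exact: leq_b1.
have /negbTE -> // : ~~ (rank u k v.+1 <= p).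
by rewrite -ltnNge (leq_trans pb) // rank_le_row.
Qed.

(** The key of u: column c lists the first [len c] values of u in increasing order. *)
Definition key_tableau u : tableau :=
  mkseq (fun p => mkseq (fun c => key_entry u (len c) p) (L p)) n.

Lemma entry_key u p c : c < L p -> entry (key_tableau u) p c = key_entry u (len c) p.
Proof.
move=> cp; rewrite /entry /key_tableau nth_mkseq ?(part_lt cp) //.
by rewrite nth_mkseq.
Qed.

Lemma rank_le_pos u a a' b : a <= a' -> rank u a b <= rank u a' b.
Proof. by rewrite -!(rankV u); apply: rank_le_row. Qed.

Lemma rank_top u a : a <= n -> rank u a n = a.
Proof. by rewrite -rankV; apply: rank_n. Qed.

Lemma key_entry_lt_n u p c : c < L p -> key_entry u (len c) p < n.
Proof.
by move=> cp; rewrite key_entry_lt // rank_top ?len_le // (lt_col_len lamP).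
Qed.

Lemma ssyt_key u : ssyt lam (key_tableau u).
Proof.
apply/(ssytP lamP); split.
- apply: (@eq_from_nth _ 0); first by rewrite size_map size_mkseq size_tuple.
  move=> p; rewrite size_map size_mkseq => pn.
  by rewrite (nth_map [::]) ?size_mkseq // nth_mkseq // size_mkseq.
- by move=> p c cp; rewrite entry_key // key_entry_lt_n.
- move=> p c c' cc' cp; rewrite !entry_key //; last exact: leq_ltn_trans cp.
  apply: leq_sum => v _; case: (leqP (rank u (len c) v.+1) p) => //= h.
  rewrite (leq_trans _ h) //; apply: rank_le_pos; apply: leq_sum => q _.
  by case: (ltnP c' (L q)) => // /(leq_ltn_trans cc') ->.
move=> p c cp; rewrite !entry_key //; last exact: leq_trans cp (part_le lamP (leqnSn p)).
have bn := key_entry_lt_n u cp; set b := key_entry u _ p.+1 in bn *.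
rewrite key_entry_lt; last exact: ltnW.
have : p.+1 < rank u (len c) b.+1 by rewrite -key_entry_lt.
rewrite (rankSr u (len c) (Ordinal bn)) /=; case: (_ < len c); lia.
Qed.

Lemma below_key u c b : below lam (key_tableau u) c b = rank u (len c) b.
Proof.
have le_len : rank u (len c) b <= len c by rewrite -rankV; apply: rank_le.
transitivity (\sum_(0 <= p < n) (p < rank u (len c) b)).
  apply: eq_bigr => p _; case: (ltnP c (L p)) => /= cp; last first.
    by rewrite ltnNge (leq_trans le_len) // leqNgt (lt_col_len lamP) ltnNge cp.
  rewrite entry_key //; have [bn|nb] := leqP b n; first by rewrite key_entry_lt.
  rewrite (ltn_trans (key_entry_lt_n u cp) nb).
  have := rank_le_row u (len c) (ltnW nb); rewrite rank_top ?len_le // => h.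
  by rewrite (leq_trans _ h) // (lt_col_len lamP).
by rewrite sum_ltn; have := len_le lam c; lia.
Qed.

Lemma demazure_key u : demazure lam u (key_tableau u).
Proof.
apply/(demazureP lamP); split; first exact: ssyt_key.
exists (fun=> u); split=> [c|c|c b]; try exact: rank_order_refl.
exact: below_key.
Qed.

Lemma down_right_le i u : rank_order (down_right i u) u.
Proof. by move=> a b; rewrite -(rankV (down_right i u)) -(rankV u) invgK; apply: down_le. Qed.

(** At a descent, s_i u would be shorter and, by [chain_down_right], define the same Demazure
    crystal. *)
Lemma minimal_increasing u i : minimal_for_demazure lam u -> L i = L i.+1 ->
  u (lo i) < u (hi i).
Proof.
move=> min_u eL; rewrite ltnNge; apply/negP => desc.
have ds : ~~ ascent u^-1%g i by rewrite /ascent /place invgK -leqNgt.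
pose u' := (adjacent_transposition i * u)%g.
have def_u' : down_right i u = u'.
  by rewrite /down_right /weak_down (negbTE ds) invMg invgK adjE tpermV.
have eqd : demazure lam u' = demazure lam u.
  apply/classical_sets.seteqP; split=> T /(demazureP lamP)[sT cT]; apply/(demazureP lamP); split=> //.
    by apply: chain_mono cT; rewrite -def_u'; apply: down_right_le.
  by rewrite -def_u'; apply: chain_down_right.
have := min_u _ eqd; rewrite leqNgt => /negP[].
have -> : u = (tperm (lo i) (hi i) * u')%g by rewrite mulgA tperm2 mul1g.
apply: perm_length_tperm; first by [].
rewrite !permM adjE tpermL tpermR.
move: desc; rewrite leq_eqVlt => /predU1P[/val_inj/perm_inj/(congr1 val) /=|//].
by lia.
Qed.

Lemma demazure_sub_bruhat u v : minimal_for_demazure lam u ->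
  (forall T, demazure lam u T -> demazure lam v T) -> bruhat u v.
Proof.
move=> min_u sub; apply: rank_order_bruhat.
(* The predicate marks the ends of the blocks of equal parts. For such an a, column [L a] has length
   a, so the key tableau of u exhibits the rank of u at a. *)
apply: (@rank_order_blocks _ (fun a => L a < L a.-1)) => [i /= | a b lt_a].
  rewrite -leqNgt => le; apply: minimal_increasing => //.
  by apply/eqP; rewrite eqn_leq le part_le.
have [_ [X [_ leX colX]]] := (demazureP lamP v _).1 (sub _ (demazure_key u)).
have ea : a = len (L a).
  have := lt_col_len lamP a.-1 (L a); have := lt_col_len lamP a (L a).
  by rewrite lt_a ltnn; lia.
by have := colX (L a) b; rewrite below_key -ea => ->; apply: leX.
Qed.

End Minimal.

(** * Kohnert diagrams *)

Section Kohnert.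

Local Open Scope fset_scope.
Local Open Scope nat_scope.

Implicit Types (D S : diagram).

Lemma kohnert_reach_trans D S S' :
  kohnert_reach D S -> kohnert_reach S S' -> kohnert_reach D S'.
Proof. by move=> DS; elim=> // T T' _ DT; apply: KohnertStep DT. Qed.

Lemma mem_move D i j i' x y : ((x, y) \in (i', j) |` (D `\ (i, j))) =
  (x == i') && (y == j) || ~~ ((x == i) && (y == j)) && ((x, y) \in D).
Proof. by rewrite !inE !xpair_eqE. Qed.

Lemma reach_move D S i j i' : kohnert_reach D S -> (i, j) \in S ->
  (forall k, (i, k) \in S -> k <= j) -> i' < i -> (i', j) \notin S ->
  (forall k, i' < k < i -> (k, j) \in S) ->
  kohnert_reach D ((i', j) |` (S `\ (i, j))).
Proof. by move=> DS *; apply: (KohnertStep DS); exists i, j, i'. Qed.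

Lemma mem_swap_rows r D i j : ((i, j) \in swap_rows r D) = ((swap_index r i, j) \in D).
Proof.
have swapK : involutive (swap_index r).
  by move=> k; rewrite /swap_index; do 4?case: eqP; lia.
apply/imfsetP/idP => /= [[[a b] abD [-> ->]]|iD]; first by rewrite swapK.
by exists (swap_index r i, j) => //=; rewrite swapK.
Qed.

Lemma fset_bound S : exists m, forall x y : nat, (x, y) \in S -> y < m.
Proof.
exists (\max_(c <- S) c.2).+1 => x y xyS; rewrite ltnS.
exact: (@leq_bigmax_seq _ _ xpredT (fun c : nat * nat => c.2) _ xyS isT).
Qed.

(** The cells are raised from right to left, so that each is rightmost in its row when it moves. *)
Lemma reach_raise_columns D S r m : kohnert_reach D S ->
  (forall y, m <= y -> (r.+1, y) \in S -> (r, y) \notin S) ->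
  exists2 S', kohnert_reach D S' &
  [/\ forall y, ((r, y) \in S') = ((r, y) \in S) || (m <= y) && ((r.+1, y) \in S),
      forall y, ((r.+1, y) \in S') = (y < m) && ((r.+1, y) \in S)
    & forall x y, x != r -> x != r.+1 -> ((x, y) \in S') = ((x, y) \in S)].
Proof.
have [M boundM] := fset_bound S.
have {boundM} : forall y, (r.+1, y) \in S -> y < m + M.
  by move=> y /boundM; lia.
elim: M S => [|M IH] S boundS DS free.
  exists S => //; split=> // y; have := boundS y; first by case: (_ \in S); lia.
  by case: (_ \in S); lia.
have [inS|ninS] := boolP ((r.+1, m + M) \in S); last first.
  apply: IH => // y yS; have := boundS _ yS; rewrite addnS ltnS leq_eqVlt.
  by case/predU1P => // ey; move: ninS; rewrite -ey yS.
have ninS : (r, m + M) \notin S by apply: free => //; apply: leq_addr.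
pose S1 := (r, m + M) |` (S `\ (r.+1, m + M)).
have DS1 : kohnert_reach D S1.
  apply: reach_move => //; first by move=> k /boundS; lia.
  by move=> k; lia.
have [||S' DS' [S'r S'r1 S'x]] := IH S1 _ DS1.
- by move=> y; rewrite mem_move => h; have := boundS y; move: h; case: (_ \in S); lia.
- move=> y my; rewrite !mem_move; have := free y my.
  by case: ((r.+1, y) \in S); case: ((r, y) \in S); lia.
exists S' => //; split=> [y|y|x y xr xr1].
- rewrite S'r !mem_move; case: (y =P m + M) => [->|_]; first by rewrite inS; lia.
  by case: ((r.+1, y) \in S); case: ((r, y) \in S); lia.
- rewrite S'r1 !mem_move; case: (y =P m + M) => [->|_]; first by rewrite inS; lia.
  by case: ((r.+1, y) \in S); lia.
by rewrite S'x // mem_move (negbTE xr) (negbTE xr1).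
Qed.

(** Let m be the least bound on the columns of row r. The northwest condition at the last cell of
    row r makes the two rows agree before m, so the exchange raises exactly the cells of row r+1
    from column m on. *)
Lemma swap_rows_reach D r : northwest D ->
  (forall c, (r, c) \in D -> (r.+1, c) \in D) -> kohnert_reach D (swap_rows r D).
Proof.
move=> nwD subD.
have exm : exists m, all (fun c => (c.1 == r) ==> (c.2 < m)) (enum_fset D).
  have [m hm] := fset_bound D; exists m; apply/allP => -[x y] xyD /=.
  by apply/implyP => _; apply: hm xyD.
have [m /allP rowm minm] := ex_minnP exm.
have lt_m y : (r, y) \in D -> y < m by move=> yD; have := rowm _ yD; rewrite /= eqxx.
have ge_m y : y < m -> (r.+1, y) \in D -> (r, y) \in D.
  case: m minm lt_m {rowm} => // m minm lt_m ym yD.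
  have : ~~ all (fun c => (c.1 == r) ==> (c.2 < m)) (enum_fset D).
    by apply/negP => /minm; rewrite ltnn.
  rewrite -has_predC => /hasP[[a b] abD]; rewrite /= negb_imply -leqNgt.
  case/andP => /eqP ea mb; rewrite {a}ea in abD.
  have := lt_m _ abD => bm; have [yb|yb] := eqVneq y b; first by rewrite yb.
  by apply: nwD yD abD; lia.
have [|S' DS' [S'r S'r1 S'x]] := reach_raise_columns (KohnertRefl D) (m := m) (r := r).
  by move=> y my _; apply/negP => /lt_m; lia.
suff -> : swap_rows r D = S' by [].
apply/fsetP => -[x y]; rewrite mem_swap_rows /swap_index.
case: (x =P r) => [->|/eqP xr].
  by rewrite S'r; have := subD y; have := ge_m y; have := lt_m y; do 2?case: (_ \in D); lia.
case: (x =P r.+1) => [->|/eqP xr1]; last by rewrite S'x.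
by rewrite S'r1; have := subD y; have := ge_m y; have := lt_m y; do 2?case: (_ \in D); lia.
Qed.

(* R is a set of cells of row r+1 of S which may be raised to row r, and the
   diagram S2 obtained from S by raising them is reachable from swap_rows r D.
   Initially R consists of all cells of row r+1 of D without cell above them.
   The condition on row r makes the cells of R unpaired, so R is empty as soon
   as e_r(S) = 0. *)
Lemma reach_raised D S r :
  (forall c, (r, c) \in D -> (r.+1, c) \in D) -> kohnert_reach D S ->
  exists R : pred nat, exists2 S2, kohnert_reach (swap_rows r D) S2 &
  [/\ forall y, R y -> ((r.+1, y) \in S) && ((r, y) \notin S),
      forall j y, (r, j) \in S -> R y -> j < y -> (r.+1, j) \in S,
      forall y, ((r, y) \in S2) = ((r, y) \in S) || R y,
      forall y, ((r.+1, y) \in S2) = ((r.+1, y) \in S) && ~~ R y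
    & forall x y, x != r -> x != r.+1 -> ((x, y) \in S2) = ((x, y) \in S)].
Proof.
move=> subD; elim=> [|S0 S1 _ [R [S2 K2 [R1 R2 S2r S2r1 S2x]]] [i [j [i' [[ijS jmax] i'i i'jS fill ->]]]]].
  exists (fun y => ((r.+1, y) \in D) && ((r, y) \notin D)).
  exists (swap_rows r D); first exact: KohnertRefl.
  split=> // [j y /subD //|y|y|x y xr xr1]; rewrite mem_swap_rows /swap_index ?eqxx.
  - by have := subD y; do 2?case: (_ \in D); lia.
  - by rewrite (gtn_eqF (ltnSn r)); have := subD y; do 2?case: (_ \in D); lia.
  by rewrite (negbTE xr) (negbTE xr1).
have fillR y : R y -> ~~ ((r, y) \in S0) by move/R1/andP => [].
have nRj y : ~~ R j -> R y -> y != j by move=> nj Ry; apply: contraNneq nj => <-.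
have S2_fill x : ~~ R j -> i' < x < i -> (x, j) \in S2.
  move=> nj hx; have := fill _ hx; case: (x =P r) => [->|/eqP xr]; first by rewrite S2r => ->.
  by case: (x =P r.+1) => [->|/eqP xr1]; [rewrite S2r1 nj => -> | rewrite S2x].
(* The ordinary case: S2 makes the same move and R is kept. The last two premises ensure that a cell
   arriving at (r, j) has a cell below it whenever R has a column right of j. *)
have same : ~~ R j -> (i, j) \in S2 -> (forall k, (i, k) \in S2 -> k <= j) ->
    (i', j) \notin S2 ->
    (i' == r) ==> ((r.+1, j) \in S0) || (i == r.+1) -> (forall y, R y -> j < y -> i != r.+1) ->
    exists R : pred nat, exists2 S2, kohnert_reach (swap_rows r D) S2 &
  [/\ forall y, R y -> ((r.+1, y) \in (i', j) |` (S0 `\ (i, j))) &&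
        ((r, y) \notin (i', j) |` (S0 `\ (i, j))),
      forall j' y, (r, j') \in (i', j) |` (S0 `\ (i, j)) -> R y -> j' < y ->
        (r.+1, j') \in (i', j) |` (S0 `\ (i, j)),
      forall y, ((r, y) \in S2) = ((r, y) \in (i', j) |` (S0 `\ (i, j))) || R y,
      forall y, ((r.+1, y) \in S2) = ((r.+1, y) \in (i', j) |` (S0 `\ (i, j))) && ~~ R y
    & forall x y, x != r -> x != r.+1 ->
        ((x, y) \in S2) = ((x, y) \in (i', j) |` (S0 `\ (i, j)))].
  move=> nj ij2 max2 i'j2 G1 G2; exists R, ((i', j) |` (S2 `\ (i, j))).
    by apply: reach_move => // x; apply: S2_fill.
  split.
  - by move=> y Ry; rewrite !mem_move (negbTE (nRj y nj Ry)) !andbF /=; apply: R1.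
  - move=> k y; rewrite !mem_move; case: (k =P j) => [->|_].
      move=> h Ry jy; have := G2 y Ry jy; have := R2 j y; rewrite Ry jy.
      by move: h G1; do 2?case: (_ \in S0); lia.
    by rewrite !andbF /=; apply: R2.
  - move=> y; rewrite !mem_move S2r; case: (y =P j) => [->|_]; last by rewrite !andbF.
    by rewrite (negbTE nj) !orbF.
  - move=> y; rewrite !mem_move S2r1; case: (y =P j) => [->|_]; last by rewrite !andbF.
    by rewrite (negbTE nj) !andbT.
  by move=> x y xr xr1; rewrite !mem_move S2x.
have [ei|/eqP neir] := i =P r.
  subst i; have nj : ~~ R j by apply: contraL ijS => /fillR.
  have i'r : i' != r by lia.
  have i'r1 : i' != r.+1 by lia.
  (* If R has a column right of j, then (r, j) is not rightmost in S2, but (r+1, j) is present. Once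
     the cells of row r+1 further right are raised, it jumps over (r, j) to the target, and R gains
     j and the columns of those cells. *)
  have [|none] := boolP (has (fun c => [&& c.1 == r.+1, R c.2 & j < c.2]) (enum_fset S0)).
    case/hasP => -[a y] /= _ /and3P[_ Ry jy].
    have jS : (r.+1, j) \in S0 by apply: (R2 j y).
    have [|S3 K3 [S3r S3r1 S3x]] := reach_raise_columns K2 (m := j.+1) (r := r).
      move=> k jk; rewrite S2r1 S2r => /andP[_ nk]; rewrite negb_or nk andbT.
      by apply/negP => /jmax; lia.
    exists (fun y => R y || (j <= y) && ((r.+1, y) \in S0)).
    exists ((i', j) |` (S3 `\ (r.+1, j))).
      apply: reach_move K3 _ _ _ _ _.
      - by rewrite S3r1 ltnSn S2r1 jS nj.
      - by move=> k; rewrite S3r1; lia.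
      - by lia.
      - by rewrite S3x // S2x.
      move=> k hk; have [->|/eqP kr] := k =P r; first by rewrite S3r S2r ijS.
      by rewrite S3x ?S2x //; [apply: fill; lia | lia | lia].
    split.
    - move=> k; rewrite !mem_move; case: (k =P j) => [->|/eqP kj].
        by rewrite jS (negbTE nj) eqxx /=; lia.
      rewrite !andbF /= => /orP[/R1 //|/andP[jk ->]] /=.
      by apply: contra kj => /jmax kj; rewrite eqn_leq kj.
    - move=> k z; rewrite !mem_move; case: (k =P j) => [->|/eqP kj].
        by rewrite eqxx eq_sym (negbTE i'r).
      rewrite !andbF /= => kS _ _; apply: (R2 k y) => //.
      by apply: ltn_trans jy; rewrite ltn_neqAle kj jmax.
    - move=> k; rewrite !mem_move S3r S2r S2r1; case: (k =P j) => [->|/eqP kj].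
        by rewrite ijS jS leqnn (ltn_eqF (ltnSn r)) /= !orbT.
      rewrite !andbF /= [j <= k]leq_eqVlt eq_sym (negbTE kj) /= -orbA.
      by case: (R k); rewrite /= ?orbT ?andbT ?andbF.
    - move=> k; rewrite !mem_move S3r1 S2r1; case: (k =P j) => [->|/eqP kj].
        by rewrite jS !leqnn eqxx [r.+1 == i']eq_sym (negbTE i'r1) /= orbT andbF.
      rewrite !andbF /= ltnS [k <= j]leqNgt [j <= k]leq_eqVlt eq_sym (negbTE kj) /= negb_or.
      by case: (R k); case: (_ \in S0); case: (j < k).
    move=> x k xr xr1; rewrite !mem_move S3x // S2x //.
    by rewrite (negbTE xr) (negbTE xr1).
  apply: same => //.
  - by rewrite S2r ijS.
  - move=> k; rewrite S2r => /orP[/jmax //|Rk]; rewrite leqNgt; apply: contra none => jk.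
    have /andP[kS _] := R1 _ Rk.
    by apply/hasP; exists (r.+1, k) => //=; rewrite eqxx Rk.
  - by rewrite S2x.
  - by rewrite (negbTE i'r).
  by move=> *; lia.
have [ei|/eqP neir1] := i =P r.+1.
  subst i; have [ei'|/eqP i'r] := i' =P r.
    (* If j is in R, this move has already been made in S2, and j only leaves R. *)
    subst i'; have [Rj|nj] := boolP (R j).
      exists (fun y => R y && (y != j)); exists S2 => //; split.
      - move=> y /andP[Ry yj]; rewrite !mem_move (negbTE yj) !andbF /=; exact: R1.
      - move=> k y; rewrite !mem_move; case: (k =P j) => [->|_].
          by move=> _ /andP[/R1/andP[/jmax yj _] _]; lia.
        by rewrite !andbF /= => kS /andP[Ry _]; apply: R2.
      - move=> y; rewrite mem_move S2r; case: (y =P j) => [->|_]; first by rewrite Rj eqxx; lia.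
        by rewrite !andbF !andbT.
      - move=> y; rewrite mem_move S2r1; case: (y =P j) => [->|_]; first by rewrite Rj eqxx; lia.
        by rewrite !andbF !andbT.
      by move=> x y xr xr1; rewrite mem_move (negbTE xr) (negbTE xr1) S2x.
    apply: same => //.
    - by rewrite S2r1 ijS.
    - by move=> k; rewrite S2r1 => /andP[/jmax].
    - by rewrite S2r (negbTE i'jS).
    - by rewrite !eqxx orbT.
    by move=> y /R1/andP[/jmax]; lia.
  have ijr : (r, j) \in S0 by apply: fill; lia.
  have nj : ~~ R j by apply: contraL ijr => /fillR.
  apply: same => //.
  - by rewrite S2r1 ijS.
  - by move=> k; rewrite S2r1 => /andP[/jmax].
  - by rewrite S2x //; lia.
  - by rewrite (negbTE i'r).
  by move=> y /R1/andP[/jmax]; lia.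
have ij2 : (i, j) \in S2 by rewrite S2x.
have max2 k : (i, k) \in S2 -> k <= j by rewrite S2x //; apply: jmax.
have [ei'|/eqP i'r] := i' =P r.
  subst i'; have jS : (r.+1, j) \in S0 by apply: fill; lia.
  have [Rj|nj] := boolP (R j); last first.
    apply: same => //; first by rewrite S2r (negbTE i'jS).
    by rewrite jS implybT.
  (* In S2 the place (r+1, j) is empty and (r, j) is occupied: the cell stops one row lower, and j
     leaves R. *)
  exists (fun y => R y && (y != j)); exists ((r.+1, j) |` (S2 `\ (i, j))).
    apply: reach_move => //; first by lia.
      by rewrite S2r1 Rj andbF.
    move=> x hx; rewrite S2x; [apply: fill; lia | lia | lia].
  split.
  - move=> y /andP[Ry yj]; rewrite !mem_move (negbTE yj) !andbF /=; exact: R1.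
  - move=> k y; rewrite !mem_move; case: (k =P j) => [->|_].
      by rewrite jS; lia.
    by rewrite !andbF /= => kS /andP[Ry _]; apply: R2.
  - move=> y; rewrite !mem_move S2r; case: (y =P j) => [->|_]; first by rewrite Rj eqxx; lia.
    by rewrite !andbF !andbT.
  - move=> y; rewrite !mem_move S2r1; case: (y =P j) => [->|_]; first by rewrite jS Rj eqxx; lia.
    by rewrite !andbF !andbT.
  by move=> x y xr xr1; rewrite !mem_move (negbTE xr) (negbTE xr1) S2x.
have [ei'|/eqP i'r1] := i' =P r.+1.
  subst i'; have nj : ~~ R j by apply: contra i'jS => /R1/andP[].
  apply: same => //; first by rewrite S2r1 (negbTE i'jS).
  by rewrite (gtn_eqF (ltnSn r)).
have [Rj|nj] := boolP (R j); last first.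
  apply: same => //; first by rewrite S2x.
  by rewrite (negbTE i'r).
(* The place (r, j) is empty, so the move cannot jump over row r and stays on one side of rows r and
   r+1. *)
have far x : i' < x < i -> (x != r) && (x != r.+1).
  move=> hx; have nr : ~~ (i' < r < i) by apply: contra (fillR _ Rj); apply: fill.
  by lia.
exists R, ((i', j) |` (S2 `\ (i, j))).
  apply: reach_move => //; first by rewrite S2x.
  by move=> x hx; have /andP[xr xr1] := far _ hx; rewrite S2x // fill.
split=> [y /R1|k y|y|y|x y xr xr1]; rewrite !mem_move;
  rewrite ?(eq_sym _ i) ?(eq_sym _ i') ?(negbTE neir) ?(negbTE neir1) ?(negbTE i'r) ?(negbTE i'r1) //=.
- by apply: R2.
by rewrite S2x.
Qed.

End Kohnert.

(* Highest weight elements and comparison of the two decompositions *)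
From mathcomp Require Import boolp classical_sets functions.

(** An element of A before b can pair only with its own copy in B: a pair reaching further would
    need that copy to be paired already. Nothing before b is left to pair with b. *)
Lemma unpaired_internal (A B : seq nat) b : b \in B -> b \notin A ->
  (forall a, a \in A -> a < b -> a \in B) -> b \in unpaired A B.
Proof.
move=> bB bA AB; rewrite mem_filter bB andbT; apply/mapP => -[p pM eb].
have diag M q : formed A B M -> q \in M -> q.1 < b -> q.2 = q.1.
  elim: M q => //= p' M IH q /and4P[p1 p2 /and5P[le nM _ _ /allP inB] fM].
  rewrite inE => /predU1P[->|qM] lt; last exact: IH.
  have aB := AB _ p1 lt; apply/eqP; rewrite eqn_leq le andbT leqNgt.
  apply: contra nM => lt12; have := inB _ aB; rewrite leqnn lt12 => /mapP[q' q'M e].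
  have [_ _ le'] := formed_sub fM q'M.
  have e' := IH q' fM q'M; rewrite -e in le' e'; rewrite e'; last exact: leq_ltn_trans lt.
  exact: map_f.
have [pA _ le] := formed_sub (formed_pairing A B) pM.
have [lt|ge] := ltnP p.1 b.
  by have := diag _ _ (formed_pairing A B) pM lt; move: lt; rewrite -eb => + e; rewrite e ltnn.
by move: bA; rewrite (_ : b = p.1) ?pA //; apply/eqP; rewrite eqn_leq ge eb le.
Qed.

Lemma mem_row_columns (T : diagram) i y : (y \in row_columns T i) = ((i, y) \in T).
Proof.
apply/mapP/idP => [[[a b]]|yT].
  by rewrite mem_filter => /andP[/= /eqP-> abT ->].
by exists (i, y) => //; rewrite mem_filter /= eqxx.
Qed.

Lemma highest_reach_swap (D T : diagram) r :
  (forall c, (r, c) \in D -> (r.+1, c) \in D) ->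
  kohnert_reach D T -> kohnert_raise r T = None -> kohnert_reach (swap_rows r D) T.
Proof.
move=> subD DT none; have [R [T2 KT2 [R1 R2 T2r T2r1 T2x]]] := reach_raised subD DT.
have noR y : R y = false.
  apply/negP => Ry; have /andP[yB yA] := R1 _ Ry.
  have : y \in unpaired (row_columns T r) (row_columns T r.+1).
    by apply: unpaired_internal; rewrite ?mem_row_columns // => a;
       rewrite !mem_row_columns => aT ay; apply: R2 ay.
  move: none; rewrite /kohnert_raise; case E: rightmost => [//|] _.
  by rewrite (rightmost_None E).
suff -> : T = T2 by [].
apply/fsetP => -[x y].
have [->|/eqP xr] := x =P r; first by rewrite T2r noR orbF.
have [->|/eqP xr1] := x =P r.+1; first by rewrite T2r1 noR andbT.
by rewrite T2x.
Qed.

Lemma swap_rows_id (D : diagram) r :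
  (forall c, (r, c) \notin D) -> (forall c, (r.+1, c) \notin D) -> swap_rows r D = D.
Proof.
move=> Dr Dr1; apply/fsetP => -[x y]; rewrite mem_swap_rows /swap_index.
case: eqP => [->|_]; first by rewrite (negbTE (Dr _)) (negbTE (Dr1 _)).
by case: eqP => [->|//]; rewrite (negbTE (Dr _)) (negbTE (Dr1 _)).
Qed.

Lemma highest_weight n (lam : n.-tuple nat) i : i < n ->
  tableau_weight (highest lam) i = nth 0 lam i.
Proof.
move=> ltin; rewrite /tableau_weight count_flatten sumnE /highest /mkseq -map_comp big_map.
rewrite (bigD1_seq i) ?mem_iota ?iota_uniq //= big1 => [|p /negbTE np].
  by rewrite count_nseq /= eqxx mul1n addn0.
by rewrite count_nseq /= np.
Qed.

Section Decomposition.

Variables (n : nat) (D : diagram) (s : nat) (mu : 'I_s -> n.-tuple nat) (u : 'I_s -> 'S_n).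
Hypothesis muP : forall k, is_partition (mu k).

Let union := [set x : 'I_s * tableau | demazure (mu x.1) (u x.1) x.2]%classic.

Variable f : 'I_s * tableau -> diagram.
Hypothesis f_bij : set_bij union (KD D) f.
Hypothesis f_raise : forall x (i : 'I_n.-1), union x ->
  kohnert_raise i (f x) = omap (fun b => f (x.1, b)) (tableau_raise i x.2).

Lemma demazure_highest k : demazure (mu k) (u k) (highest (mu k)).
Proof.
by apply/(demazureP (muP k)); split; [apply: ssyt_highest | apply: chain_highest].
Qed.

Lemma highest_in_KD k : KD D (f (k, highest (mu k))) /\
  forall i : 'I_n.-1, kohnert_raise i (f (k, highest (mu k))) = None.
Proof.
case: f_bij => fun_f _ _; split; first exact: (fun_f (k, highest (mu k)) (demazure_highest k)).
by move=> i; rewrite (@f_raise (k, highest (mu k)) i (demazure_highest k)) /= raise_highest.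
Qed.

Lemma highest_from_KD T : KD D T -> (forall i : 'I_n.-1, kohnert_raise i T = None) ->
  exists k, T = f (k, highest (mu k)).
Proof.
case: f_bij => _ _ surj_f /surj_f[[k b] dkb <-] none; exists k.
have [sb cb] := (demazureP (muP k) _ _).1 dkb.
rewrite -(highest_unique (muP k) sb _ cb) // => i.
by have := none i; rewrite (@f_raise (k, b) i dkb) /=; case: tableau_raise.
Qed.

End Decomposition.

Lemma demazure_raise n (lam : n.-tuple nat) (w : 'S_n) (i : 'I_n.-1) T T' :
  is_partition lam -> demazure lam w T -> tableau_raise i T = Some T' -> demazure lam w T'.
Proof.
move=> lamP /(demazureP lamP)[sT cT] r; apply/(demazureP lamP).
by split; [case: (raise_spec lamP sT r) | apply: (chain_raise lamP sT r cT)].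
Qed.

Theorem theorem3p15 (n : nat) (D : diagram) (r : nat)
    (hn : forall i j : nat, (i, j) \in D -> i < n)
    (hD : northwest D)
    (hr : forall c : nat, (r, c) \in D -> (r.+1, c) \in D)
    (s t : nat)
    (mu : 'I_s -> n.-tuple nat) (u : 'I_s -> 'S_n)
    (nu : 'I_t -> n.-tuple nat) (v : 'I_t -> 'S_n)
    (hmu : forall k : 'I_s, is_partition (mu k))
    (hnu : forall k : 'I_t, is_partition (nu k))
    (hsD : demazure_decomposition (swap_rows r D) mu u)
    (hDD : demazure_decomposition D nu v)
    (hu : forall k : 'I_s, minimal_for_demazure (mu k) (u k))
    (hv : forall k : 'I_t, minimal_for_demazure (nu k) (v k)) :
  s = t /\
  exists sigma : 'I_s -> 'I_t,
    bijective sigma /\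
    forall k : 'I_s, mu k = nu (sigma k) /\ bruhat (u k) (v (sigma k)).
Proof.
case: hsD => f [f_bij f_wt f_raise]; case: hDD => g [g_bij g_wt g_raise].
have sub T : KD (swap_rows r D) T -> KD D T.
  by apply: kohnert_reach_trans; apply: swap_rows_reach.
have sup T : KD D T -> (forall i : 'I_n.-1, kohnert_raise i T = None) -> KD (swap_rows r D) T.
  (* When e_r is not among the operators of GL_n, rows r and r+1 of D are empty and the exchange is
     trivial. *)
  move=> DT none; have [rn|nr] := ltnP r n.-1.
    exact: (highest_reach_swap hr DT (none (Ordinal rn))).
  have Dr1 c : (r.+1, c) \notin D by apply/negP => /hn; lia.
  have Dr c : (r, c) \notin D by apply: contra (Dr1 c); apply: hr.
  by rewrite swap_rows_id.
have dF k := demazure_highest u hmu k; have dG k := demazure_highest v hnu k.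
have [sigma sigmaP] : {sigma & forall k, f (k, highest (mu k)) = g (sigma k, highest (nu (sigma k)))}.
  apply: (choice (P := fun k k' => f (k, highest (mu k)) = g (k', highest (nu k')))) => k.
  have [KDf none] := highest_in_KD hmu f_bij f_raise k.
  exact: (highest_from_KD hnu g_bij g_raise (sub _ KDf) none).
have [tau tauP] : {tau & forall k, g (k, highest (nu k)) = f (tau k, highest (mu (tau k)))}.
  apply: (choice (P := fun k k' => g (k, highest (nu k)) = f (k', highest (mu k')))) => k.
  have [KDg none] := highest_in_KD hnu g_bij g_raise k.
  exact: (highest_from_KD hmu f_bij f_raise (sup _ KDg none) none).
case: (f_bij) => f_fun f_inj f_surj; case: (g_bij) => g_fun g_inj g_surj.
have sigma_bij : bijective sigma.
  exists tau => k.
    have := sigmaP k; rewrite tauP => /f_inj; rewrite !in_setE => /(_ (dF _) (dF _)).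
    by case.
  have := tauP k; rewrite sigmaP => /g_inj; rewrite !in_setE => /(_ (dG _) (dG _)).
  by case.
split; first by have := bij_eq_card sigma_bij; rewrite !card_ord.
exists sigma; split=> // k.
(* A partition is the weight of its highest weight tableau, and both bijections preserve weights. *)
have emu : mu k = nu (sigma k).
  apply: val_inj; apply: (@eq_from_nth _ 0) => [|i]; first by rewrite !size_tuple.
  rewrite size_tuple => ltin; rewrite -!highest_weight //.
  rewrite -(f_wt (k, highest (mu k)) (dF k)) sigmaP.
  exact: (g_wt (sigma k, highest (nu (sigma k))) (dG _)).
split=> //.
(* Induction from the highest weight element downwards: f (k, b) is some g (k2, b2), the case of e_i
   b identifies k2 and e_i b2, and injectivity of e_i on tableaux gives b2 = b. *)
have incl b : demazure (mu k) (u k) b ->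
    f (k, b) = g (sigma k, b) /\ demazure (nu (sigma k)) (v (sigma k)) b.
  elim/ltn_ind: {b}(defect (mu k) b) {-2}b (erefl (defect (mu k) b)) => m IH b def_m db.
  have [sb cb] := (demazureP (hmu k) _ _).1 db.
  have [none|/existsNP[i]] := pselect (forall i : 'I_n.-1, tableau_raise i b = None).
    have -> := highest_unique (hmu k) sb none cb.
    by rewrite sigmaP emu; split=> //; apply: dG.
  case E: tableau_raise => [b1|//] _.
  have db1 := demazure_raise (hmu k) db E.
  have [|fg1 dv1] := IH _ _ _ erefl db1.
    by rewrite -def_m; apply: (raise_defect (hmu k) sb E).
  have [[k2 b2] dv2 g2] := g_surj _ (sub _ (f_fun (k, b) db)).
  have := f_raise (k, b) i db; rewrite /= -g2 (g_raise (k2, b2) i dv2) E /=.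
  case E2: (tableau_raise i b2) => [b3|//] [g3].
  have dv3 := demazure_raise (hnu k2) dv2 E2.
  have := g_inj (k2, b3) (sigma k, b1); rewrite !in_setE => /(_ dv3 dv1).
  rewrite g3 fg1 => /(_ erefl) [ek2 eb3].
  move: dv2 g2; rewrite /= ek2 => dv2 g2; rewrite eb3 in E2.
  have [sb2 _] := (demazureP (hnu _) _ _).1 dv2; rewrite -emu in sb2.
  have eb := tableau_raise_inj (hmu k) sb sb2 E E2.
  by rewrite eb.
apply: (demazure_sub_bruhat (hmu k) (hu k)) => T /incl[_].
by rewrite emu.
Qed.
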